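(* Let $A$ be a Cohen-Macaulay local ring of dimension $d\ge1$ with infinite residue field and let $M$ be a maximal Cohen-Macaulay $A$-module. Let $I$ be an $\mathfrak m$-primary ideal of $A$ (where $\mathfrak m$ is the maximal ideal of $A$) with $r(I)\le 1$. Then for every $i\ge1$, $\deg t^A_{I,i}(M,z)$ is either $-\infty$ or $d-1$.
   Context: Rings are Noetherian, modules finitely generated, $\ell$ denotes length. An ideal $J\subseteq I$ is a reduction of $I$ if there is $m$ with $JI^n=I^{n+1}$ for all $n\ge m$; the least such $m$ is $r_J(I)$. A reduction is minimal if it is minimal with respect to inclusion. The reduction number is $r(I)=\min\{r_J(I)\mid J \text{ a minimal reduction of } I\}$. For $i\ge1$, $t^A_{I,i}(M,z)$ is the polynomial which agrees with $n\mapsto\ell(\operatorname{Tor}_i^A(M,A/I^{n+1}))$ for $n\gg0$ (known to exist). The zero polynomial has degree $-\infty$. *)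

(* Defs.v *)
From HB Require Import structures.
From mathcomp Require Import all_boot all_algebra.
From mathcomp Require Import boolp classical_sets functions cardinality.

Set Implicit Arguments.
Unset Strict Implicit.
Unset Printing Implicit Defensive.

Import GRing.Theory.
Local Open Scope ring_scope.
Local Open Scope quotient_scope.

(* Submodules are [submodClosed U] (boolean predicates with closure proofs,
   classical reasoning turning any Prop-valued predicate into a boolean one);
   ideals of A, proper or not, are the submodules of the regular module A^o. *)
Notation ideal A := (submodClosed A^o).

Section Submodules.
Variables (A : comNzRingType) (U : lmodType A).

Definition full_pred : {pred U} := fun _ => true.

Fact full_closed : submod_closed full_pred.
Proof. by split. Qed.

HB.instance Definition _ :=
  GRing.isSubmodClosed.Build A U full_pred full_closed.

Definition fullS : submodClosed U := full_pred.

Definition lspan_pred (xs : seq U) : {pred U} := fun v =>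
  `[< exists c : 'I_(size xs) -> A, v = \sum_i c i *: xs`_i >].

Fact lspan_closed xs : submod_closed (lspan_pred xs).
Proof.
split=> [|a u v /asboolP[c ->] /asboolP[d ->]]; apply/asboolP.
  by exists (fun=> 0); rewrite big1 // => i _; rewrite scale0r.
exists (fun i => a * c i + d i); rewrite scaler_sumr -big_split /=.
by apply: eq_bigr => i _; rewrite scalerDl scalerA.
Qed.

HB.instance Definition _ xs :=
  GRing.isSubmodClosed.Build A U (lspan_pred xs) (lspan_closed xs).

Definition lspan (xs : seq U) : submodClosed U := lspan_pred xs.

Definition mulS_pred (J : ideal A) (S : submodClosed U) : {pred U} := fun v =>
  `[< exists n (a : 'I_n -> A) (u : 'I_n -> U),
        (forall i, a i \in J /\ u i \in S) /\ v = \sum_i a i *: u i >].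

Fact mulS_closed J S : submod_closed (mulS_pred J S).
Proof.
split=> [|c v w /asboolP[m [a [u [au ->]]]] /asboolP[n [b [t [bt ->]]]]];
  apply/asboolP.
  exists 0, (fun=> 0), (fun=> 0); split; last by rewrite big_ord0.
  by case.
exists (m + n)%N, (fun i : 'I_(m + n) => match fintype.split i with inl j => c * a j | inr k => b k end),
  (fun i : 'I_(m + n) => match fintype.split i with inl j => u j | inr k => t k end); split.
  move=> i; case: (fintype.split i) => [j|k]; last exact: bt.
  by have [aJ uS] := au j; split=> //; exact: (rpredZ (s := J) c).
rewrite big_split_ord /= scaler_sumr; congr (_ + _); apply: eq_bigr => i _.
  by rewrite -[lshift n i]/(unsplit (inl i)) unsplitK scalerA.
by rewrite -[rshift m i]/(unsplit (inr i)) unsplitK.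
Qed.

HB.instance Definition _ J S :=
  GRing.isSubmodClosed.Build A U (mulS_pred J S) (mulS_closed J S).

Definition mulS (J : ideal A) (S : submodClosed U) : submodClosed U :=
  mulS_pred J S.

Definition properS (S T : submodClosed U) : Prop :=
  {subset S <= T} /\ exists2 x, x \in T & x \notin S.

(* Only the terms N 0, ..., N k are relevant. *)
Definition strict_chain (N : nat -> submodClosed U) (k : nat) : Prop :=
  forall i, (i < k)%N -> properS (N i) (N i.+1).

Definition finitely_generated : Prop :=
  exists xs : seq U, forall u : U, u \in lspan xs.

End Submodules.
Arguments fullS {A U}.
Arguments finitely_generated {A} U.

Fixpoint idealX (A : comNzRingType) (I : ideal A) (n : nat) : ideal A :=
  if n is n'.+1 then mulS I (idealX I n') else fullS.

Section QuotientModule.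
Variables (A : comNzRingType) (U : lmodType A) (S : submodClosed U).

Definition zmod_pred : {pred U} := S.

HB.instance Definition _ :=
  GRing.isSubmodClosed.Build A U zmod_pred (submodClosedP S).

(* S as an additive subgroup of U *)
Definition zmodS : zmodClosed U := zmod_pred.

(* the library's quotient group U / S, with its module structure below *)
Definition quotmod : Type := Quotient.quot zmodS.

HB.instance Definition _ := GRing.Zmodule.on quotmod.

Let cls (u : U) : quotmod := \pi_(Quotient.quot zmodS) u.

Definition quotmod_scale (a : A) (x : quotmod) : quotmod :=
  cls (a *: repr (x : Quotient.quot zmodS)).

Let clsE u v : u - v \in S -> cls u = cls v.
Proof. by move=> uv; apply/eqmodP; rewrite /Quotient.equiv. Qed.

Let repr_cls u : u - repr (cls u : Quotient.quot zmodS) \in S.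
Proof.
have /eqmodP : \pi_(Quotient.quot zmodS) u = \pi_(Quotient.quot zmodS)
   (repr (cls u : Quotient.quot zmodS)) by rewrite reprK.
by [].
Qed.

Let scale_cls a u : quotmod_scale a (cls u) = cls (a *: u).
Proof.
apply/clsE; rewrite -scalerBr; apply: (rpredZ (s := S)).
by rewrite -[_ \in S]/(_ \in zmodS) -opprB rpredN repr_cls.
Qed.

Let clsD u v : cls (u + v) = cls u + cls v.
Proof. by rewrite /cls raddfD. Qed.

Let clsP (x : quotmod) : exists u, x = cls u.
Proof. by exists (repr (x : Quotient.quot zmodS)); rewrite /cls reprK. Qed.

Fact quotmod_scaleA a b x :
  quotmod_scale a (quotmod_scale b x) = quotmod_scale (a * b) x.
Proof. by have [u ->] := clsP x; rewrite !scale_cls scalerA. Qed.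

Fact quotmod_scale1 : left_id 1 quotmod_scale.
Proof. by move=> x; have [u ->] := clsP x; rewrite scale_cls scale1r. Qed.

Fact quotmod_scaleDr : right_distributive quotmod_scale +%R.
Proof.
move=> a x y; have [u ->] := clsP x; have [v ->] := clsP y.
by rewrite -clsD !scale_cls scalerDr clsD.
Qed.

Fact quotmod_scaleDl x : {morph quotmod_scale^~ x : a b / a + b}.
Proof.
by move=> a b; have [u ->] := clsP x; rewrite !scale_cls scalerDl clsD.
Qed.

HB.instance Definition _ := GRing.Zmodule_isLmodule.Build A quotmod
  quotmod_scaleA quotmod_scale1 quotmod_scaleDr quotmod_scaleDl.

End QuotientModule.

Section SubModule.
Variables (A : comNzRingType) (U : lmodType A) (S : submodClosed U).

Record submod : Type := Submod { submod_val :> U; _ : submod_val \in S }.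

HB.instance Definition _ := [isSub for submod_val].
HB.instance Definition _ := [Choice of submod by <:].
HB.instance Definition _ := [SubChoice_isSubLmodule of submod by <:].

End SubModule.

(* ker g / im f, for a complex U --f--> V --g--> W *)
Section Homology.
Variables (A : comNzRingType) (U V W : lmodType A).
Variables (f : {linear U -> V}) (g : {linear V -> W}).

Definition ker_pred : {pred V} := fun v => g v == 0.

Fact ker_closed : submod_closed ker_pred.
Proof.
split=> [|a u v]; rewrite !unfold_in /ker_pred ?linear0 //.
by move=> /eqP gu /eqP gv; rewrite linearP gu gv scaler0 addr0.
Qed.

HB.instance Definition _ :=
  GRing.isSubmodClosed.Build A V ker_pred ker_closed.

Definition kerS : submodClosed V := ker_pred.

Definition im_pred : {pred submod kerS} := fun v =>
  `[< exists u, f u = submod_val v >].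

Fact im_closed : submod_closed im_pred.
Proof.
split=> [|a u v /asboolP[x fx] /asboolP[y fy]]; apply/asboolP.
  by exists 0; rewrite linear0.
by exists (a *: x + y); rewrite linearP fx fy.
Qed.

HB.instance Definition _ :=
  GRing.isSubmodClosed.Build A (submod kerS) im_pred im_closed.

Definition homology : lmodType A := quotmod (im_pred : submodClosed _).

End Homology.

(* A free resolution  ... -> A^(r 1) -> A^(r 0) -> M -> 0  by finite free
   modules; matrices act on row vectors from the right. *)
Record free_resolution (A : comNzRingType) (M : lmodType A) := FreeResolution {
  res_rank : nat -> nat;
  res_diff : forall j, 'M[A]_(res_rank j.+1, res_rank j);
  res_aug : {linear 'rV[A]_(res_rank 0) -> M};
  res_aug_surj : forall u : M, exists x, res_aug x = u;
  res_exact0 : forall x, res_aug x = 0 <-> exists y, x = y *m res_diff 0;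
  res_exactS : forall j (x : 'rV_(res_rank j.+1)),
    x *m res_diff j = 0 <-> exists y, x = y *m res_diff j.+1
}.

(* Under A^m (x) N = N^m, the map x |-> x *m D tensored with N. *)
Section TensorMap.
Variables (A : comNzRingType) (N : lmodType A) (m n : nat) (D : 'M[A]_(m, n)).

Definition tens_map (f : {ffun 'I_m -> N}) : {ffun 'I_n -> N} :=
  [ffun k => \sum_j D j k *: f j].

Fact tens_map_linear : linear tens_map.
Proof.
move=> a f g; apply/ffunP => k; rewrite !ffunE scaler_sumr -big_split /=.
apply: eq_bigr => j _; rewrite !ffunE scalerDr !scalerA.
by rewrite [D j k * a]mulrC.
Qed.

HB.instance Definition _ := GRing.isLinear.Build A
  {ffun 'I_m -> N} {ffun 'I_n -> N} *:%R tens_map tens_map_linear.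

End TensorMap.

(* Tor_i(M, N), computed from the resolution F of M: the i-th homology module
   of F (x) N, where the differential leaving degree 0 is F_0 (x) N -> 0. *)
Definition Tor (A : comNzRingType) (M : lmodType A) (F : free_resolution M)
    (N : lmodType A) (i : nat) : lmodType A :=
  if i is j.+1
  then homology (@tens_map A N _ _ (res_diff F j.+1))
                (@tens_map A N _ _ (res_diff F j))
  else homology (@tens_map A N _ _ (res_diff F 0))
                (@tens_map A N _ 0 0).

Definition is_max (P : nat -> Prop) (k : nat) : Prop :=
  P k /\ forall j, P j -> (j <= k)%N.

Definition is_min (P : nat -> Prop) (k : nat) : Prop :=
  P k /\ forall j, P j -> (k <= j)%N.

Definition has_length (A : comNzRingType) (U : lmodType A) (l : nat) : Prop :=
  is_max (fun k => exists N : nat -> submodClosed U, strict_chain N k) l.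

Section Rings.
Variable A : comNzRingType.
Implicit Types (I J P m : ideal A) (M : lmodType A).

Definition noetherian : Prop :=
  forall J, exists xs : seq A^o, J =i lspan xs.

Definition maximal_ideal m : Prop :=
  1 \notin m /\ forall J, {subset m <= J} -> 1 \notin J -> J =i m.

Definition local_ring m : Prop :=
  maximal_ideal m /\ forall m', maximal_ideal m' -> m' =i m.

Definition infinite_residue_field m : Prop :=
  infinite_set [set: quotmod m].

Definition prime_ideal P : Prop := 1 \notin P /\ prime_idealr_closed P.

Definition primary_ideal I : Prop :=
  1 \notin I /\
  forall x y : A, x * y \in I -> x \in I \/ exists n, y ^+ n \in I.

(* I is primary with radical m *)
Definition primary_to m I : Prop :=
  primary_ideal I /\ forall x : A, x \in m <-> exists n, x ^+ n \in I.

Definition annihilates M (a : A) : Prop := forall u : M, a *: u = 0.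

(* dim M = dim A / ann M: chains of primes containing ann M *)
Definition module_dim M (d : nat) : Prop :=
  is_max (fun k => exists P : nat -> ideal A,
    [/\ strict_chain P k,
        forall i, (i <= k)%N -> prime_ideal (P i)
      & forall i, (i <= k)%N -> forall a, annihilates M a -> a \in P i]) d.

Definition krull_dim (d : nat) : Prop :=
  is_max (fun k => exists P : nat -> ideal A,
    strict_chain P k /\ forall i, (i <= k)%N -> prime_ideal (P i)) d.

(* (x_1, ..., x_k) M *)
Definition seqM M (xs : seq A) : submodClosed M :=
  mulS (lspan (xs : seq A^o)) fullS.

Definition regular_seq M (xs : seq A) : Prop :=
  (forall i, (i < size xs)%N ->
     forall u : quotmod (seqM M (take i xs)), xs`_i *: u = 0 -> u = 0)
  /\ exists u : quotmod (seqM M xs), u != 0.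

Definition depth m M (k : nat) : Prop :=
  is_max (fun k => exists xs : seq A,
    [/\ size xs = k, {subset xs <= m} & regular_seq M xs]) k.

Definition cohen_macaulay m M : Prop :=
  exists k, depth m M k /\ module_dim M k.

Definition maximal_cohen_macaulay m M : Prop :=
  cohen_macaulay m M /\ exists d, krull_dim d /\ module_dim M d.

Definition reduction_from J I (k : nat) : Prop :=
  forall n, (k <= n)%N -> mulS J (idealX I n) =i idealX I n.+1.

Definition is_reduction J I : Prop :=
  {subset J <= I} /\ exists k, reduction_from J I k.

Definition minimal_reduction J I : Prop :=
  is_reduction J I /\
  forall K, is_reduction K I -> {subset K <= J} -> K =i J.

(* r_J(I) = r *)
Definition reduction_number_wrt J I (r : nat) : Prop :=
  is_min (reduction_from J I) r.

(* r(I) = r *)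
Definition reduction_number I (r : nat) : Prop :=
  is_min (fun k => exists J, minimal_reduction J I /\ reduction_number_wrt J I k)
    r.

(* t = t^A_{I,i}(M, z), Tor being computed from the resolution F of M *)
Definition is_tor_polynomial I M (F : free_resolution M) (i : nat)
    (t : {poly rat}) : Prop :=
  exists n0, forall n, (n0 <= n)%N ->
    exists l, has_length (Tor F (quotmod (idealX I n.+1)) i) l
              /\ t.[n%:R] = l%:R.

End Rings.

(* None stands for degree -oo *)
Definition poly_degree (t : {poly rat}) : option nat :=
  if t == 0 then None else Some (size t).-1.

(* Main.v *)
Require Import Defs.
From HB Require Import structures.
From mathcomp Require Import all_boot all_algebra.
From mathcomp Require Import boolp classical_sets functions cardinality.
From mathcomp Require Import ring zify.

Set Implicit Arguments.
Unset Strict Implicit.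
Unset Printing Implicit Defensive.

Import GRing.Theory.
Local Open Scope ring_scope.
Local Open Scope quotient_scope.

(** Let [J] be a minimal reduction of [I] with [J I^n = I^(n+1)] for [n >= 1],
    so that [I^(n+1) = J^n I] for all [n]. Suppose that [J] is generated by [d]
    elements that form a regular sequence on both [A] and [M]. Regular sequences
    are quasi-regular ([quasi_regular]): a form of degree [n] in the generators
    that lies in [J^n K], for an ideal [K] containing [J], has its coefficients
    in [K]. On the one hand [Tor_i (M, A / J)] vanishes for [i >= 1], hence so
    does [Tor_i (M, A / J^n)], by induction on [n] ([exact_mod_power]). On the
    other hand [J^n / J^n I] is a sum of copies of [A / I], one for each monomial
    of degree [n] in [d] variables. The sequence
    [0 -> J^n / J^n I -> A / J^n I -> A / J^n -> 0] then makes
    [Tor_i (M, A / I^(n+1))] a sum of [binomial (n + d - 1) (d - 1)] copies of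
    [Tor_i (M, A / I)] ([tor_len_power]). Its length is that binomial times a
    constant: a polynomial in [n] that is zero or has degree [d - 1].

    That [J] has [d] generators is a count of lengths
    ([minimal_reduction_generators]). Let [J] have [s] generators, [s] minimal. If a
    form of degree [e] in them with a unit among its coefficients lies in
    [m I^e], then, the residue field being infinite, the form takes a unit
    value at some point, and moving this point to a coordinate point shows that
    one generator is integral over the others modulo [m]; by Nakayama's lemma
    the others generate a reduction, against the minimality of [J]
    ([fewer_generators]). Without such forms the monomials of degree [e] are
    independent in [I^e / m I^e], and the length of [A / I^N] is at least
    [binomial (N + s - 1) s]. But [I] contains an [A]-regular sequence of length
    [d], which generates an ideal primary to [m] since [dim A = d]
    ([regular_parameters]); so this length is at most a multiple of
    [binomial (N + d - 1) d], and [s <= d].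

    Regular generators come from general position ([exchange]). Given regular
    sequences of length [d] in [m] on [A] and on [M], a general combination [z]
    of the generators of [J] avoids the associated primes of all the successive
    quotients, because such a prime containing [J] would be [m]; it can be
    moved to the front of both sequences at the expense of their last terms, and
    the process continues modulo [z].

    All modules occur as intervals between submodules of one fixed module:
    regularity on [U / S] and lengths of subquotients are statements about
    submodules of [U], and no iterated quotient is formed. *)

(** * Submodules *)

(** Submodules with the same elements are equal, the closure proofs being
    propositions; this allows rewriting inside quotients. *)
Lemma submod_ext (A : comNzRingType) (U : lmodType A) (S T : submodClosed U) :
  S =i T -> S = T.
Proof.
case: S T => [s cs] [t ct] /= E.
have est : s = t.
  by apply/funext => x; have := E x; rewrite /in_mem /=.
case: t / est ct E => ct _.
case: cs => [[a] [b]]; case: ct => [[a1] [b1]].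
by rewrite (Prop_irrelevance a a1) (Prop_irrelevance b b1).
Qed.

Lemma memN (A : comNzRingType) (U : lmodType A) (S : submodClosed U) u :
  u \in S -> - u \in S.
Proof. by move=> uS; rewrite -scaleN1r rpredZ. Qed.
Lemma memB (A : comNzRingType) (U : lmodType A) (S : submodClosed U) u v :
  u \in S -> v \in S -> u - v \in S.
Proof. by move=> uS vS; rewrite rpredD // memN. Qed.

Section Submodules.
Variables (A : comNzRingType) (U : lmodType A).
Implicit Types (S T W : submodClosed U) (J K : ideal A).

Lemma sub_mem_eq S T : {subset S <= T} -> {subset T <= S} -> S =i T.
Proof. by move=> ST TS x; apply/idP/idP; auto. Qed.

Lemma sub_antiS S T : {subset S <= T} -> {subset T <= S} -> S = T.
Proof. by move=> ST TS; apply: submod_ext => x; apply/idP/idP; auto. Qed.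

(** The constructions below define a submodule from a [Prop]-valued predicate,
    through [mkS]. *)
Definition lin_closed (P : U -> Prop) :=
  P 0 /\ forall a u v, P u -> P v -> P (a *: u + v).

Definition mk_pred P & lin_closed P : {pred U} := fun v => `[< P v >].
Fact mk_closed P hP : submod_closed (@mk_pred P hP).
Proof.
case: (hP) => h0 hD; split=> [|a u v /asboolP uP /asboolP vP]; apply/asboolP=> //.
exact: hD.
Qed.
HB.instance Definition _ P hP :=
  GRing.isSubmodClosed.Build A U (@mk_pred P hP) (mk_closed hP).
Definition mkS P (hP : lin_closed P) : submodClosed U := mk_pred hP.
Lemma mkSP P (hP : lin_closed P) v : v \in mkS hP <-> P v.
Proof. by split=> [/asboolP|] // ?; apply/asboolP. Qed.

Fact zeroS_lin : lin_closed (fun v => v = 0).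
Proof. by split=> // a u v -> ->; rewrite scaler0 addr0. Qed.
Definition zeroS := mkS zeroS_lin.
Lemma zeroSP v : v \in zeroS <-> v = 0.
Proof. exact: mkSP. Qed.

Fact addS_lin S T : lin_closed (fun v => exists2 t, t \in T & v - t \in S).
Proof.
split=> [|a u v [t tT ut] [w wT vw]]; first by exists 0; rewrite ?subr0 ?rpred0.
exists (a *: t + w); first by rewrite rpredD ?rpredZ.
have -> : a *: u + v - (a *: t + w) = a *: (u - t) + (v - w).
  by rewrite scalerBr opprD addrACA.
by rewrite rpredD ?rpredZ.
Qed.
Definition addS S T := mkS (addS_lin S T).
Lemma addSP S T v : v \in addS S T <-> exists2 t, t \in T & v - t \in S.
Proof. exact: mkSP. Qed.

Lemma addSl S T : {subset S <= addS S T}.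
Proof. by move=> x xS; apply/addSP; exists 0; rewrite ?subr0 ?rpred0. Qed.
Lemma addSr S T : {subset T <= addS S T}.
Proof. by move=> x xS; apply/addSP; exists x; rewrite ?subrr ?rpred0. Qed.
Lemma addS_sub S T W :
  {subset S <= W} -> {subset T <= W} -> {subset addS S T <= W}.
Proof.
move=> SW TW v /addSP[t tT vt].
by rewrite -(subrK t v); apply: rpredD; [exact: SW | exact: TW].
Qed.

Fact addx_lin S x : lin_closed (fun v => exists u, v - x *: u \in S).
Proof.
split=> [|a u v [t ut] [w vw]]; first by exists 0; rewrite scaler0 subr0 rpred0.
exists (a *: t + w).
have -> : a *: u + v - x *: (a *: t + w) = a *: (u - x *: t) + (v - x *: w).
  by rewrite scalerDr opprD addrACA scalerBr !scalerA [x * a]mulrC.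
by rewrite rpredD ?rpredZ.
Qed.
Definition addx S x := mkS (addx_lin S x).
Lemma addxP S x v : v \in addx S x <-> exists u, v - x *: u \in S.
Proof. exact: mkSP. Qed.
Lemma addxl S x : {subset S <= addx S x}.
Proof. by move=> v vS; apply/addxP; exists 0; rewrite scaler0 subr0. Qed.
Lemma addxr S x u : x *: u \in addx S x.
Proof. by apply/addxP; exists u; rewrite subrr rpred0. Qed.
Lemma addx_sub S x W :
  {subset S <= W} -> (forall u, x *: u \in W) -> {subset addx S x <= W}.
Proof.
move=> SW xW v /addxP[u vu].
by rewrite -(subrK (x *: u) v); apply: rpredD; [exact: SW | exact: xW].
Qed.
Lemma addxC S x y : addx (addx S x) y = addx (addx S y) x.
Proof.
by apply: sub_antiS => v; apply: addx_sub; try apply: addx_sub;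
  move=> *; do ?[exact: addxr | apply: addxl].
Qed.

Fact addc_lin S u : lin_closed (fun v => exists a, v - a *: u \in S).
Proof.
split=> [|a v w [b vb] [c wc]]; first by exists 0; rewrite scale0r subr0 rpred0.
exists (a * b + c).
have -> : a *: v + w - (a * b + c) *: u = a *: (v - b *: u) + (w - c *: u).
  by rewrite scalerDl opprD addrACA scalerBr scalerA.
by rewrite rpredD ?rpredZ.
Qed.
Definition addc S u := mkS (addc_lin S u).
Lemma addcP S u v : v \in addc S u <-> exists a, v - a *: u \in S.
Proof. exact: mkSP. Qed.
Lemma addcl S u : {subset S <= addc S u}.
Proof. by move=> v vS; apply/addcP; exists 0; rewrite scale0r subr0. Qed.
Lemma addcr S u : u \in addc S u.
Proof. by apply/addcP; exists 1; rewrite scale1r subrr rpred0. Qed.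
Lemma addc_sub S u W : {subset S <= W} -> u \in W -> {subset addc S u <= W}.
Proof.
move=> SW uW v /addcP[a va].
by rewrite -(subrK (a *: u) v); apply: rpredD; [exact: SW | exact: rpredZ].
Qed.

Lemma sumS S n (a : 'I_n -> A) (u : 'I_n -> U) :
  (forall i, u i \in S) -> \sum_i a i *: u i \in S.
Proof. by move=> uS; apply: rpred_sum => i _; exact: rpredZ. Qed.

Lemma lspanP (xs : seq U) v :
  v \in lspan xs <-> exists c : 'I_(size xs) -> A, v = \sum_i c i *: xs`_i.
Proof. by split=> [/asboolP|] // ?; apply/asboolP. Qed.

Lemma lspan_sub (xs : seq U) W :
  (forall x, x \in xs -> x \in W) -> {subset lspan xs <= W}.
Proof.
by move=> xW v /lspanP[c ->]; apply: sumS => i; apply: xW; rewrite mem_nth.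
Qed.

Lemma mem_lspan (xs : seq U) x : x \in xs -> x \in lspan xs.
Proof.
move=> xxs; apply/lspanP.
have h : (index x xs < size xs)%N by rewrite index_mem.
exists (fun i => (i == Ordinal h)%:R).
rewrite (bigD1 (Ordinal h)) //= eqxx scale1r nth_index // big1 ?addr0 //.
by move=> i /negPf ->; rewrite scale0r.
Qed.

Lemma lspan_mono (xs ys : seq U) : {subset xs <= ys} -> {subset lspan xs <= lspan ys}.
Proof. by move=> h; apply: lspan_sub => x /h; exact: mem_lspan. Qed.

Lemma lspan_nil v : v \in lspan ([::] : seq U) <-> v = 0.
Proof.
split=> [/lspanP[c ->]|->]; last exact: rpred0.
by rewrite big_ord0.
Qed.

Lemma lspan_cat (xs ys : seq U) : lspan (xs ++ ys) = addS (lspan xs) (lspan ys).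
Proof.
apply: sub_antiS.
  apply: lspan_sub => x; rewrite mem_cat => /orP[]/mem_lspan h.
    exact: addSl.
  exact: addSr.
by apply: addS_sub; apply: lspan_mono => x xs'; rewrite mem_cat xs' ?orbT.
Qed.

Lemma lspan_cons x (xs : seq U) : lspan (x :: xs) = addc (lspan xs) x.
Proof.
apply: sub_antiS.
  apply: lspan_sub => y; rewrite inE => /orP[/eqP->|/mem_lspan h].
    exact: addcr.
  exact: addcl.
apply: addc_sub; last by apply: mem_lspan; rewrite inE eqxx.
by apply: lspan_mono => y; rewrite inE orbC => ->.
Qed.

Lemma mulSP J S v : v \in mulS J S <-> exists n (a : 'I_n -> A) (u : 'I_n -> U),
        (forall i, a i \in J /\ u i \in S) /\ v = \sum_i a i *: u i.
Proof. by split=> [/asboolP|] // ?; apply/asboolP. Qed.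

Lemma mulS_mem J S a u : a \in J -> u \in S -> a *: u \in mulS J S.
Proof.
move=> aJ uS; apply/mulSP; exists 1%N, (fun=> a), (fun=> u); split=> //.
by rewrite big_ord1.
Qed.

Lemma mulS_sub J S W :
  (forall a u, a \in J -> u \in S -> a *: u \in W) -> {subset mulS J S <= W}.
Proof.
move=> h v /mulSP[n [a [u [au ->]]]]; apply: rpred_sum => i _.
by case: (au i) => *; exact: h.
Qed.

Lemma mulS_mono J K S T :
  {subset J <= K} -> {subset S <= T} -> {subset mulS J S <= mulS K T}.
Proof. by move=> JK ST; apply: mulS_sub => a u /JK aK /ST; exact: mulS_mem. Qed.

Lemma mulS_subr J S : {subset mulS J S <= S}.
Proof. by apply: mulS_sub => a u _; exact: rpredZ. Qed.

Lemma mul1S S : mulS fullS S = S.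
Proof.
apply: sub_antiS; first exact: mulS_subr.
by move=> x xS; rewrite -[x]scale1r mulS_mem.
Qed.

End Submodules.
Arguments zeroS {A U}.

Section Colon.
Variables (A : comNzRingType) (U : lmodType A).
Implicit Types (S T W : submodClosed U) (J K : ideal A).
Fact colon_lin S u : @lin_closed A A^o (fun a : A^o => (a : A) *: u \in S).
Proof.
split=> [|a b c bS cS]; first by rewrite scale0r rpred0.
have -> : ((a *: b + c : A^o) : A) *: u = a *: ((b : A) *: u) + (c : A) *: u.
  by rewrite scalerA -scalerDl.
by apply: rpredD => //; exact: rpredZ.
Qed.
Definition colon S u : ideal A := mkS (colon_lin S u).
Lemma colonP S u (a : A) : a \in colon S u <-> a *: u \in S.
Proof. exact: (mkSP (colon_lin S u) a). Qed.

Fact pre_lin (V : lmodType A) (f : {linear U -> V}) (S : submodClosed V) :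
  lin_closed (fun u => f u \in S).
Proof.
by split=> [|a u v uS vS]; rewrite ?linear0 ?rpred0 // linearP rpredD ?rpredZ.
Qed.
End Colon.

Section Preim.
Variables (A : comNzRingType) (U V : lmodType A) (f : {linear U -> V}).
Definition preS (S : submodClosed V) : submodClosed U := mkS (pre_lin f S).
Lemma preSP S u : u \in preS S <-> f u \in S.
Proof. exact: mkSP. Qed.

Fact im_lin (S : submodClosed U) : lin_closed (fun v => exists2 u, u \in S & f u = v).
Proof.
split=> [|a _ _ [u uS <-] [v vS <-]]; first by exists 0; rewrite ?rpred0 ?linear0.
by exists (a *: u + v); rewrite ?linearP // rpredD ?rpredZ.
Qed.
Definition imS S := mkS (im_lin S).
Lemma imSP S v : v \in imS S <-> exists2 u, u \in S & f u = v.
Proof. exact: mkSP. Qed.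
End Preim.

(** Closure properties of ideals with the operations of the ring [A] rather
    than those of the module [A^o], which differ for rewriting. *)
Lemma ideal0 (A : comNzRingType) (J : ideal A) : (0 : A) \in J.
Proof. exact: (rpred0 J). Qed.
Lemma idealD (A : comNzRingType) (J : ideal A) (x y : A) :
  x \in J -> y \in J -> x + y \in J.
Proof. exact: (rpredD (S := J)). Qed.
Lemma idealB (A : comNzRingType) (J : ideal A) (x y : A) :
  x \in J -> y \in J -> x - y \in J.
Proof. exact: (memB (S := J)). Qed.
Lemma idealM (A : comNzRingType) (J : ideal A) (a x : A) : x \in J -> a * x \in J.
Proof. exact: (rpredZ (s := J) a). Qed.
Lemma idealMr (A : comNzRingType) (J : ideal A) (a x : A) : x \in J -> x * a \in J.
Proof. by rewrite mulrC; exact: idealM. Qed.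

Section MulIdeal.
Variables (A : comNzRingType) (U : lmodType A).
Implicit Types (S T W : submodClosed U) (I J K L : ideal A).

Lemma mulSA J K S : mulS J (mulS K S) = mulS (mulS J K) S.
Proof.
apply: sub_antiS.
  apply: mulS_sub => a u aJ uKS.
  suff : {subset mulS K S <= preS (GRing.scale a) (mulS (mulS J K) S)}.
    by move/(_ _ uKS)/preSP.
  apply: mulS_sub => b v bK vS; apply/preSP; rewrite /= scalerA.
  by apply: mulS_mem => //; exact: (mulS_mem (U := A^o) aJ bK).
apply: mulS_sub => a u aJK uS; apply/colonP; move: a aJK.
apply: mulS_sub => a b aJ bK; apply/colonP; rewrite -scalerA.
by rewrite !mulS_mem.
Qed.

End MulIdeal.

Section IdealPowers.
Variables (A : comNzRingType).
Implicit Types (I J K L : ideal A).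

Lemma mulSC J K : mulS J K = mulS K J :> ideal A.
Proof.
by apply: sub_antiS; apply: mulS_sub => a b ? ?; rewrite /GRing.scale /= mulrC;
   apply: (mulS_mem (U := A^o)).
Qed.

Lemma mulSCA (U : lmodType A) J K (S : submodClosed U) : mulS J (mulS K S) = mulS K (mulS J S).
Proof. by rewrite !mulSA [mulS J K]mulSC. Qed.

Lemma mulS_subl J K : {subset mulS J K <= J}.
Proof. by rewrite mulSC; exact: mulS_subr. Qed.

Lemma idealX1 I : idealX I 1 = I.
Proof.
rewrite /= mulSC; exact: mul1S.
Qed.

Lemma idealXD I k n : idealX I (k + n) = mulS (idealX I k) (idealX I n).
Proof.
elim: k => [|k IH] /=; first by rewrite mul1S.
by rewrite IH mulSA.
Qed.

Lemma idealX_mem I x n : x \in I -> x ^+ n \in idealX I n.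
Proof.
move=> xI; elim: n => [|n IH] //; rewrite exprS.
exact: (mulS_mem (U := A^o)).
Qed.

Lemma idealX_mono I J n : {subset I <= J} -> {subset idealX I n <= idealX J n}.
Proof. by move=> IJ; elim: n => [|n IH] //=; exact: mulS_mono. Qed.
End IdealPowers.

(** * Noetherian modules and local rings *)

Section Noeth.
Variables (A : comNzRingType) (U : lmodType A).
Implicit Types (S T W : submodClosed U).

Definition noethM := forall S, exists xs : seq U, S = lspan xs.

(** Without a maximal element, dependent choice gives a strictly increasing
    sequence, whose union is finitely generated, hence equal to one of its
    terms. *)
Lemma noeth_max : noethM -> forall (P : submodClosed U -> Prop) S0, P S0 ->
  exists S, [/\ P S, {subset S0 <= S} &
    forall T, P T -> {subset S <= T} -> T = S].
Proof.
move=> noeth P S0 PS0; apply: contrapT => noS.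
have step (S : {S | P S}) : exists T : {S | P S},
    {subset S0 <= sval S} -> {subset sval S <= sval T} /\ sval T <> sval S.
  case: S => S PS /=; have [S0S|] := EM {subset S0 <= S}; last by exists (exist _ S PS).
  have [T] : exists T, [/\ P T, {subset S <= T} & T <> S].
    apply: contrapT => noT; apply: noS; exists S; split=> // T PT ST.
    by apply: contrapT => TS; apply: noT; exists T.
  by case=> PT ST TS; exists (exist _ T PT).
have [f fP] := choice step.
pose N k := iter k f (exist _ S0 PS0).
have S0N k : {subset S0 <= sval (N k)}.
  elim: k => [|k IH] // x xS0; have [h _] := fP _ IH.
  by apply/h/IH.
have Nmono j k : (j <= k)%N -> {subset sval (N j) <= sval (N k)}.
  elim: k => [|k IH]; first by rewrite leqn0 => /eqP ->.
  rewrite leq_eqVlt => /orP[/eqP -> //|]; rewrite ltnS => /IH h x /h xN.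
  by have [g _] := fP _ (S0N k); exact: g.
have lU : lin_closed (fun u => exists k, u \in sval (N k)).
  split; first by exists 0; exact: rpred0.
  move=> a u v [j uj] [k vk]; exists (maxn j k); rewrite rpredD ?rpredZ //.
    by apply: Nmono uj; rewrite leq_maxl.
  by apply: Nmono vk; rewrite leq_maxr.
have [xs E] := noeth (mkS lU).
have [k kP] : exists k, forall x, x \in xs -> x \in sval (N k).
  have : forall x, x \in xs -> exists k, x \in sval (N k).
    by move=> x /mem_lspan; rewrite -E => /mkSP.
  elim: xs {E} => [|x xs IH] h; first by exists 0.
  have [|j jP] := IH; first by move=> y yxs; apply: h; rewrite inE yxs orbT.
  have [|k kP] := h x; first by rewrite inE eqxx.
  exists (maxn j k) => y; rewrite inE => /orP[/eqP ->|/jP].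
    by apply: Nmono kP; rewrite leq_maxr.
  by apply: Nmono; rewrite leq_maxl.
have [h] := fP _ (S0N k); case; apply: sub_antiS => // x xN.
have : x \in mkS lU by apply/mkSP; exists k.+1.
by rewrite E; apply: lspan_sub.
Qed.

Lemma noeth_ind : noethM -> forall (P : submodClosed U -> Prop),
  (forall S, (forall T, properS S T -> P T) -> P S) -> forall S, P S.
Proof.
move=> noeth P h S; apply: contrapT => nPS.
have [T [nPT _ Tmax]] := noeth_max noeth (P := fun S => ~ P S) nPS.
apply: nPT; apply: h => W [TW [x xW xT]]; apply: contrapT => nPW.
by move: xT; rewrite -(Tmax _ nPW TW) xW.
Qed.
End Noeth.

Section Noetherian.
Variables (A : comNzRingType).
Hypothesis A_noeth : noetherian A.

Lemma noethA : noethM A^o.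
Proof. by move=> S; have [xs /submod_ext E] := A_noeth S; exists xs. Qed.

(** Over a Noetherian ring, submodules of a finitely generated module are
    finitely generated: the leading coefficients of a submodule of
    [A x + <xs>] form an ideal, and what they do not account for lies in
    [<xs>]. *)
Lemma noethM_fg (U : lmodType A) : finitely_generated U -> noethM U.
Proof.
move=> [xs xsP] S.
suff : forall T : submodClosed U, {subset T <= lspan xs} -> exists ys : seq U, T = lspan ys.
  by move=> h; apply: (h S) => u _; exact: xsP.
elim: xs {xsP} => [|x xs IH] T Txs.
  exists [::]; apply: sub_antiS => // v /lspan_nil ->; exact: rpred0.
(* the ideal of leading coefficients *)
have hl : @lin_closed A A^o (fun a : A^o => exists2 w, w \in lspan xs & (a : A) *: x + w \in T).
  split; first by exists 0; rewrite ?rpred0 // scale0r addr0 rpred0.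
  move=> a b c [v vx bT] [w wx cT]; exists (a *: v + w); first by rewrite rpredD ?rpredZ.
  have -> : ((a *: b + c : A^o) : A) *: x + (a *: v + w) =
      a *: ((b : A) *: x + v) + ((c : A) *: x + w).
    by rewrite scalerDr addrACA scalerA -scalerDl.
  by apply: rpredD => //; exact: rpredZ.
have [bs bsE] := noethA (mkS hl).
have [us] : exists us : seq U, (forall u, u \in us -> u \in T) /\
   forall b, b \in lspan bs -> exists2 u, u \in lspan us & u - (b : A) *: x \in lspan xs.
  have : forall b, b \in bs -> exists2 w, w \in lspan xs & (b : A) *: x + w \in T.
    by move=> b bbs; apply/(mkSP hl); rewrite bsE mem_lspan.
  elim: bs {bsE} => [|b bs IHb] h.
    exists [::]; split=> // b /lspan_nil ->.
    by exists 0; rewrite ?rpred0 // scale0r subr0 rpred0.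
  have [|us [usT usP]] := IHb; first by move=> c cbs; apply: h; rewrite inE cbs orbT.
  have [|w wx bwT] := h b; first by rewrite inE eqxx.
  exists (b *: x + w :: us); split.
    by move=> u; rewrite inE => /orP[/eqP ->|/usT].
  move=> c; rewrite lspan_cons => /addcP[a /usP[u uus uc]].
  exists (u + a *: (b *: x + w)).
    rewrite lspan_cons; apply/addcP; exists a.
    by rewrite addrK.
  have -> : u + a *: (b *: x + w) - (c : A) *: x =
      (u - ((c - a *: b : A^o) : A) *: x) + a *: w.
    rewrite scalerBl scalerDr scalerA opprB -/(a * b).
    rewrite -[(a *: b : A^o)]/(a * b : A).
    by rewrite !addrA [LHS]addrAC.
  by apply: rpredD => //; exact: rpredZ.
move=> [usT usP].
have hI : lin_closed (fun u => u \in T /\ u \in lspan xs).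
  split; first by rewrite !rpred0.
  by move=> a u v [uT ux] [vT vx]; split; apply: rpredD => //; exact: rpredZ.
have [|vs vsE] := IH (mkS hI); first by move=> u /mkSP[].
have vsT : {subset lspan vs <= T} by move=> u; rewrite -vsE => /mkSP[].
have usT' : {subset lspan us <= T} by exact: lspan_sub.
exists (us ++ vs); rewrite lspan_cat; apply: sub_antiS; last exact: addS_sub.
move=> t tT; have := Txs _ tT; rewrite lspan_cons => /addcP[b tb].
have /usP[u uus ub] : b \in lspan bs.
  rewrite -bsE; apply/(mkSP hl); exists (t - b *: x) => //.
  by rewrite addrC subrK.
apply/addSP; exists (t - u); last by rewrite opprB addrC subrK.
rewrite -vsE; apply/mkSP; split; first by apply: memB => //; exact: usT'.
have -> : t - u = (t - b *: x) - (u - b *: x).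
  by rewrite opprB addrA subrK.
by rewrite memB.
Qed.

(** An ideal maximal among those that avoid the multiplicative set [X] is
    prime. *)
Lemma prime_exists (X : A -> Prop) (S : ideal A) :
  X 1 -> (forall a b, X a -> X b -> X (a * b)) ->
  (forall a, X a -> a \notin S) ->
  exists P : ideal A, [/\ prime_ideal P, {subset S <= P} & forall a, X a -> a \notin P].
Proof.
move=> X1 XM XS.
have [P [PX SP Pmax]] := noeth_max noethA
  (P := fun S : ideal A => forall a, X a -> a \notin S) XS.
exists P; split=> //; split; first exact: PX.
move=> u v uvP; apply: contrapT => /negP; rewrite negb_or => /andP[uP vP].
have meet w : w \notin P -> exists2 a : A, X a & exists b : A, a - b * w \in P.
  move=> wP; apply: contrapT => no.
  have E : addc P w = P.
    apply: Pmax; last exact: addcl.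
    move=> a Xa; apply/negP => /addcP[b]; apply: contra_not no => h.
    by exists a => //; exists b.
  by move: wP; rewrite -E addcr.
have [a Xa [b ab]] := meet u uP.
have [c Xc [d cd]] := meet v vP.
apply: (negP (PX _ (XM _ _ Xa Xc))).
have -> : a * c = (a - b * u) * c + b * u * (c - d * v) + b * d * (u * v) by ring.
by apply: rpredD; [apply: rpredD; [exact: idealMr | exact: idealM] | exact: idealM].
Qed.
End Noetherian.

Section Local.
Variables (A : comNzRingType) (m : ideal A).
Hypotheses (A_noeth : noetherian A) (A_local : local_ring m).

Lemma max1 : 1 \notin m. Proof. by case: A_local => [[]]. Qed.

Lemma proper_sub (J : ideal A) : 1 \notin J -> {subset J <= m}.
Proof.
move=> J1.
have [P [P1 JP Pmax]] := noeth_max (noethA A_noeth)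
  (P := fun S : ideal A => 1 \notin S) J1.
suff /(proj2 A_local) Pm : maximal_ideal P by move=> x /JP; rewrite Pm.
by split=> // K PK K1; rewrite (Pmax K).
Qed.

Lemma unit_notin (a : A) : a \notin m -> exists b, b * a = 1.
Proof.
move=> am; apply: contrapT => no.
have /proper_sub h : 1 \notin addc (U := A^o) zeroS a.
  apply/negP => /addcP[b /zeroSP/eqP]; rewrite subr_eq0 => /eqP ab.
  by apply: no; exists b; rewrite ab.
by move: am; rewrite h // addcr.
Qed.

Lemma max_prime (a b : A) : a * b \in m -> a \notin m -> b \in m.
Proof.
move=> abm /unit_notin[c ca].
by rewrite -[b]mul1r -ca -mulrA idealM.
Qed.

Lemma unit_1sub (a : A) : a \in m -> exists b, b * (1 - a) = 1.
Proof.
move=> am; apply: unit_notin; apply/negP => h; have := max1.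
by rewrite -(subrK a 1) rpredD.
Qed.

Lemma unit_mem (U : lmodType A) (S : submodClosed U) (a : A) u :
  a \notin m -> a *: u \in S -> u \in S.
Proof.
by move=> /unit_notin[b ba] aS; rewrite -[u]scale1r -ba -scalerA rpredZ.
Qed.

(** The relation for [t] has a coefficient [1 - a] with [a] in [m], a unit, so
    [t] can be eliminated: induction on the number of generators. *)
Lemma nakayama (U : lmodType A) (S : submodClosed U) (ts : seq U) :
  {subset lspan ts <= addS S (mulS m (lspan ts))} -> {subset lspan ts <= S}.
Proof.
elim: ts => [|t ts IH] h; first by move=> v /lspan_nil ->; exact: rpred0.
have tS : t \in addS S (mulS m (lspan ts)).
  have /addSP[w wm tw] := h t (mem_lspan (mem_head _ _)).
  have {wm} : w \in addc (mulS m (lspan ts)) t /\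
      exists2 a, a \in m & w - a *: t \in mulS m (lspan ts).
    suff hh : exists2 a, a \in m & w - a *: t \in mulS m (lspan ts).
      by split=> //; case: hh => a _ ?; apply/addcP; exists a.
    have hl : lin_closed (fun w => exists2 a, a \in m & w - a *: t \in mulS m (lspan ts)).
      split; first by exists 0; rewrite ?rpred0 // scale0r subr0 rpred0.
      move=> a u v [b bm ub] [c cm vc]; exists (a * b + c).
        by apply: rpredD => //; exact: idealM.
      have -> : a *: u + v - (a * b + c) *: t = a *: (u - b *: t) + (v - c *: t).
        by rewrite scalerDl opprD addrACA scalerBr scalerA.
      by apply: rpredD => //; exact: rpredZ.
    suff /(mkSP hl) : w \in mkS hl by [].
    move: w wm {tw}; apply: mulS_sub => a u am.
    rewrite lspan_cons => /addcP[c uc]; apply/mkSP; exists (a * c); first exact: idealMr.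
    by rewrite -scalerA -scalerBr mulS_mem.
  case=> _ [a am wa]; have [b ba] := unit_1sub am.
  apply/addSP; exists (b *: (w - a *: t)); first exact: rpredZ.
  have -> : t - b *: (w - a *: t) = b *: (t - w).
    rewrite -[X in X - _]scale1r -ba -scalerA -scalerBr scalerBl scale1r.
    by congr (_ *: _); rewrite opprB addrA subrK.
  exact: rpredZ.
have sub1 : {subset lspan (t :: ts) <= addS S (lspan ts)}.
  rewrite lspan_cons; apply: addc_sub; first exact: addSr.
  by move: tS; apply: addS_sub; [exact: addSl | move=> x /mulS_subr; exact: addSr].
have tsS : {subset lspan ts <= S}.
  apply: IH => v vts.
  have : v \in addS S (mulS m (lspan (t :: ts))).
    by apply: h; rewrite lspan_cons; exact: addcl.
  apply: addS_sub; first exact: addSl.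
  apply: mulS_sub => a u am /sub1/addSP[w wts uw].
  apply/addSP; exists (a *: w); first exact: mulS_mem.
  by rewrite -scalerBr rpredZ.
move=> v /sub1; exact: addS_sub.
Qed.

End Local.

(** * Quotients of modules *)

Section QuotPi.
Variables (A : comNzRingType) (U : lmodType A) (S : submodClosed U).

Definition qpi (u : U) : quotmod S := \pi_(Quotient.quot (zmodS S)) u.

Lemma qpi_eq u v : qpi u = qpi v <-> u - v \in S.
Proof.
split=> [/eqmodP|uv]; first by rewrite /Quotient.equiv.
by apply/eqmodP; rewrite /Quotient.equiv.
Qed.

Lemma qpi_surj (x : quotmod S) : exists u, qpi u = x.
Proof. by exists (repr (x : Quotient.quot (zmodS S))); rewrite /qpi reprK. Qed.

Lemma qpi_linear : linear qpi.
Proof.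
move=> a u v.
have -> : qpi (a *: u + v) = qpi (a *: u) + qpi v by rewrite /qpi raddfD.
congr (_ + _); rewrite /GRing.scale /= /quotmod_scale.
apply/qpi_eq; rewrite -scalerBr rpredZ //; apply/qpi_eq.
by rewrite [in RHS]/qpi reprK.
Qed.
HB.instance Definition _ :=
  GRing.isLinear.Build A U (quotmod S) *:%R qpi qpi_linear.

Lemma qpi0 u : qpi u = 0 <-> u \in S.
Proof. by rewrite -(linear0 qpi) qpi_eq subr0. Qed.
End QuotPi.

Section Residue.
Variables (A : comNzRingType) (m : ideal A).
Hypotheses (A_noeth : noetherian A) (A_local : local_ring m).
Hypothesis (A_residue : infinite_residue_field m).

Lemma residues : exists c : nat -> A, forall i j, i != j -> c i - c j \notin m.
Proof.
have /infiniteP/card_leP/unsquash f := A_residue.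
pose g (i : nat) : quotmod m := val (f (SigSub (mem_setT i))).
have gI : injective g.
  move=> i j /val_inj fij.
  by have := @inj _ _ _ f _ _ _ _ fij; rewrite !inE => /(_ I I) [].
have [c cE] := choice (fun i : nat => qpi_surj (g i)).
by exists c => i j; apply: contraNN => /qpi_eq; rewrite !cE => /gI ->.
Qed.

Variable (c : nat -> A).
Hypothesis cP : forall i j, i != j -> c i - c j \notin m.

(** The Vandermonde argument by synthetic division: dividing by [X - c i] leaves
    a quotient with values in [N], since the differences of the [c i] are units. *)
Lemma poly_residues (N : ideal A) (ks : seq nat) : uniq ks ->
  forall p : {poly A}, (size p <= size ks)%N ->
  (forall i, i \in ks -> p.[c i] \in N) -> forall j, p`_j \in N.
Proof.
elim: ks => [|i ks IH] /=.
  by move=> _ p; rewrite leqn0 size_poly_eq0 => /eqP -> _ j; rewrite coef0 ideal0.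
move=> /andP[iks uks] p sp pN.
have /factor_theorem[q pq] : root (p - (p.[c i])%:P) (c i).
  by rewrite rootE !hornerE subrr.
have pE : p = q * ('X - (c i)%:P) + (p.[c i])%:P by rewrite -pq subrK.
have sq : (size q <= size ks)%N.
  have [->|q0] := eqVneq q 0; first by rewrite size_poly0.
  have := size_Mmonic q0 (monicXsubC (c i)); rewrite -pq size_XsubC addn2 /= => E.
  rewrite -ltnS -E (leq_trans (size_polyD _ _)) // size_polyN geq_max sp.
  exact: leq_trans (size_polyC_leq1 _) _.
have qN j : q`_j \in N.
  apply: IH => // k kks.
  have ki : k != i by apply: contraNneq iks => <-.
  have := memB (pN k _) (pN i (mem_head _ _)); rewrite inE kks orbT => /(_ isT).
  rewrite {1}pE !hornerE addrK mulrC => h.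
  by apply: (unit_mem A_noeth A_local (cP ki) (U := A^o)).
move=> j; rewrite pE coefD coefC mulrBr coefB coefMX coefMC.
apply: idealD; last by case: (j == 0)%N; rewrite ?ideal0 // pN ?mem_head.
by apply: idealB; [case: (j == 0)%N; rewrite ?ideal0 | exact: idealMr].
Qed.

(** Infinitely many bad parameters would include as many as [poly_residues]
    needs. *)
Lemma poly_eventually (N : ideal A) (p : {poly A}) :
  ~ (forall j, p`_j \in N) -> exists B, forall i, (B <= i)%N -> p.[c i] \notin N.
Proof.
move=> pN; apply: contrapT => no; apply: pN.
have step B : exists i, (B <= i)%N /\ p.[c i] \in N.
  apply: contrapT => none; apply: no; exists B => i Bi.
  by apply/negP => h; apply: none; exists i.
have bad n : forall B, exists ks : seq nat, [/\ uniq ks, size ks = n,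
    forall i, i \in ks -> p.[c i] \in N & forall i, i \in ks -> (B <= i)%N].
  elim: n => [|n IH] B; first by exists [::].
  have [i [Bi iN]] := step B; have [ks [uks sks kN kB]] := IH i.+1.
  exists (i :: ks); split=> /=; rewrite ?sks //.
  - by rewrite uks andbT; apply/negP => /kB; rewrite ltnn.
  - by move=> j; rewrite inE => /orP[/eqP ->|/kN].
  - by move=> j; rewrite inE => /orP[/eqP -> //|/kB ij]; rewrite (leq_trans Bi) // ltnW.
have [ks [uks sks kN _]] := bad (size p) 0%N.
by apply: poly_residues kN; rewrite ?sks.
Qed.

End Residue.

(** * Regular sequences and general elements *)

Section Regular.
Variables (A : comNzRingType) (U : lmodType A).
Implicit Types (S T W : submodClosed U).

(** [x] is regular on [U / S] *)
Definition reg (x : A) S := forall u, x *: u \in S -> u \in S.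

Fixpoint regseq S (ys : seq A) : Prop :=
  if ys is y :: ys' then reg y S /\ regseq (addx S y) ys' else True.

Definition addxs S (ys : seq A) := foldl (@addx A U) S ys.

Lemma regseq_rcons S ys y :
  regseq S (rcons ys y) <-> regseq S ys /\ reg y (addxs S ys).
Proof.
elim: ys S => [|x ys IH] S /=; first by split=> [[]|[]].
by rewrite IH; tauto.
Qed.

Lemma addxs_rcons S ys y : addxs S (rcons ys y) = addx (addxs S ys) y.
Proof. by rewrite /addxs -cats1 foldl_cat. Qed.

Lemma addxs_lspan ys :
  addxs zeroS ys = mulS (lspan (ys : seq A^o)) (fullS : submodClosed U).
Proof.
elim/last_ind: ys => [|ys y IH].
  apply: sub_antiS => u; first by move/zeroSP ->; exact: rpred0.
  by apply: mulS_sub => a v /lspan_nil -> _; rewrite scale0r rpred0.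
rewrite addxs_rcons IH; apply: sub_antiS.
  apply: addx_sub => [|u].
    by apply: mulS_mono => //; apply: lspan_mono => x; rewrite mem_rcons inE orbC => ->.
  by apply: mulS_mem => //; apply: mem_lspan; rewrite mem_rcons mem_head.
apply: mulS_sub => a u; rewrite -cats1 lspan_cat => /addSP[t].
rewrite lspan_cons => /addcP[b /lspan_nil/eqP]; rewrite subr_eq0 => /eqP ->.
move=> at_ _; apply/addxP; exists (b *: u).
rewrite scalerA mulrC -scalerBl; exact: mulS_mem.
Qed.

(** Finiteness of the associated primes of [U / S], in the form that each
    nonzero class has a multiple whose annihilator is one of them. For [u] with
    prime annihilator [P] in [U / S], the associated primes are among [P] and
    those of [U / (S + A u)], which Noetherian induction provides. *)
Lemma ass_primes : noetherian A -> noethM U -> forall S,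
  exists n (P : nat -> ideal A), forall u, u \notin S ->
    exists a k, [/\ (k < n)%N, a *: u \notin S, prime_ideal (P k) & P k = colon S (a *: u)].
Proof.
move=> A_noeth U_noeth; apply: (noeth_ind U_noeth) => S IH.
have [[u0 u0S]|full] := EM (exists u, u \notin S); last first.
  by exists 0%N, (fun=> fullS) => u uS; case: full; exists u.
have [P [[u uS uP] _ Pmax]] := noeth_max (noethA A_noeth)
  (P := fun P => exists2 u, u \notin S & P = colon S u)
  (ex_intro2 _ _ u0 u0S erefl).
have Ppr : prime_ideal P.
  split; first by rewrite uP; apply/negP => /colonP; rewrite scale1r (negPf uS).
  move=> a b; rewrite uP => /colonP abu; apply: contrapT => /negP.
  rewrite negb_or => /andP[/negP aP /negP bP]; apply: aP.
  have buS : b *: u \notin S by apply/negP => h; apply: bP; apply/colonP.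
  have := Pmax (colon S (b *: u)); rewrite uP => <-.
  - by apply/colonP; rewrite scalerA.
  - by exists (b *: u).
  - by move=> x /colonP xu; apply/colonP; rewrite scalerA mulrC -scalerA rpredZ.
have [|n [Q QP]] := IH (addc S u).
  by split; [exact: addcl | exists u => //; exact: addcr].
exists n.+1, (fun k => if k is k'.+1 then Q k' else P) => v vS.
have inC w : w \in addc S u -> w \notin S -> P = colon S w.
  move=> /addcP[b wb] wS; have bP : b \notin P.
    rewrite uP; apply/negP => /colonP bu; move/negP: wS; apply.
    by rewrite -(subrK (b *: u) w) rpredD.
  have E x : (x *: w \in S) <-> (x * b \in P).
    rewrite uP; have -> : (x * b \in colon S u) <-> (x * b) *: u \in S by exact: colonP.
    rewrite -scalerA; split=> h; last first.
      by rewrite -(subrK (b *: u) w) scalerDr rpredD // rpredZ.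
    by rewrite -(subKr w (b *: u)) scalerBr memB // rpredZ.
  apply: sub_antiS => x xP.
    by apply/colonP/E; exact: idealMr.
  have /E/(proj2 Ppr)/orP[] // : x *: w \in S by apply/colonP.
  by rewrite (negPf bP).
have [vu|vu] := boolP (v \in addc S u).
  by exists 1, 0%N; rewrite scale1r; split=> //; exact: inC.
have [a [k [kn avu Qp QE]]] := QP v vu.
have [[b [bv bvS]]|no] := EM (exists b, b *: (a *: v) \in addc S u /\ b *: (a *: v) \notin S).
  by exists (b * a), 0%N; rewrite -scalerA; split=> //; exact: inC.
exists a, k.+1; split=> //; first by apply: contraNN avu; exact: addcl.
rewrite QE; apply: sub_antiS => x /colonP xav; apply/colonP; last exact: addcl.
by apply: contrapT => /negP h; apply: no; exists x.
Qed.
End Regular.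

(** [S] contains [(y ^ n - e) U], with [e] in the ideal of [xs], for each [y] in
    [m]: primes that contain [xs] and the annihilator of [U / S] contain [m]. *)
Definition parametric (A : comNzRingType) (m : ideal A) (U : lmodType A)
    (S : submodClosed U) (xs : seq A) :=
  forall y, y \in m -> exists n (e : A), e \in lspan (xs : seq A^o) /\
    forall u : U, (y ^+ n - e) *: u \in S.

Lemma Poly_coefs (A : comNzRingType) (J : ideal A) (xs : seq A) :
  (forall j, (Poly xs)`_j \in J) -> {subset lspan (xs : seq A^o) <= J}.
Proof.
move=> h; apply: lspan_sub => x xs_x.
by have := h (index x xs); rewrite coef_Poly nth_index.
Qed.

Section General.
Variables (A : comNzRingType) (m : ideal A).
Hypotheses (A_noeth : noetherian A) (A_local : local_ring m).
Variable (c : nat -> A).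
Hypothesis cP : forall i j, i != j -> c i - c j \notin m.

Lemma prime_exp (P : ideal A) (y : A) n : prime_ideal P -> y ^+ n \in P -> y \in P.
Proof.
move=> [P1 Pp]; elim: n => [|n IH]; first by rewrite expr0 (negPf P1).
by rewrite exprS => /Pp/orP[].
Qed.

Section OneModule.
Variable (U : lmodType A).
Hypothesis U_noeth : noethM U.
Implicit Types (S T W : submodClosed U).

Lemma parametricS S T xs : {subset S <= T} -> parametric m S xs -> parametric m T xs.
Proof.
by move=> ST h y /h[n [e [ex eS]]]; exists n, e; split=> // u; exact/ST/eS.
Qed.

(** A zero divisor on [U / S] lies in an associated prime. A combination of [xs]
    with general parameter avoids those that do not contain [xs]; the others
    would contain [m], hence the regular element [y]. *)
Lemma reg_eventually S xs y : parametric m S xs -> y \in m -> reg y S ->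
  exists B, forall i, (B <= i)%N -> reg (Poly xs).[c i] S.
Proof.
move=> Sxs ym yS; have [n [P PP]] := ass_primes A_noeth U_noeth S.
have [B BP] : exists B, forall k, (k < n)%N -> ~ (forall j, (Poly xs)`_j \in P k) ->
    forall i, (B <= i)%N -> (Poly xs).[c i] \notin P k.
  elim: n {PP} => [|n [B BP]]; first by exists 0%N.
  have [hn|/(poly_eventually A_noeth A_local cP)[B' B'P]] := EM (forall j, (Poly xs)`_j \in P n).
    exists B => k; rewrite ltnS leq_eqVlt => /orP[/eqP -> //|]; exact: BP.
  exists (maxn B B') => k; rewrite ltnS leq_eqVlt => /orP[/eqP -> _|kn kP] i;
    rewrite geq_max => /andP[Bi B'i]; [exact: B'P | exact: BP].
exists B => i Bi u xu; apply: contrapT => /negP /PP[a [k [kn auS Pp PE]]].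
have xP : (Poly xs).[c i] \in P k.
  by rewrite PE; apply/colonP; rewrite scalerA mulrC -scalerA rpredZ.
have [/Poly_coefs h|h] := EM (forall j, (Poly xs)`_j \in P k); last first.
  by move/negP: (BP _ kn h _ Bi).
suff : y \in P k by rewrite PE => /colonP/yS; rewrite (negPf auS).
have [l [e [exs eS]]] := Sxs _ ym.
apply: (prime_exp (n := l)) => //; rewrite -(subrK e (y ^+ l)).
by apply: idealD; [rewrite PE; apply/colonP; exact: eS | exact: h].
Qed.

(** If [y] is regular on [U / S] and [z] on [U / (S + y U)], then [y] is
    regular on [U / (S + z U)] as soon as [z] is regular on [U / S]: this lets
    a general [z] replace the last term of a regular sequence and come first. *)
Lemma exchange_step ys y S xs : parametric m S xs ->
  (forall x, x \in y :: ys -> x \in m) -> regseq S (y :: ys) ->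
  exists B, forall i, (B <= i)%N -> let z := (Poly xs).[c i] in
    reg z S /\ regseq (addx S z) (belast y ys).
Proof.
elim: ys y S => [|y' ys IH] y S Sxs ysm; move=> /= [yS].
  move=> _; have [|B BP] := reg_eventually Sxs _ yS; first exact/ysm/mem_head.
  by exists B => i Bi; split=> //; exact: BP.
move=> ysS.
have [||B BP] := IH y' (addx S y) _ _ ysS.
- by apply: parametricS Sxs; exact: addxl.
- by move=> x xys; apply: ysm; rewrite inE xys orbT.
have [|B' B'P] := reg_eventually Sxs _ yS; first exact/ysm/mem_head.
exists (maxn B B') => i; rewrite geq_max => /andP[/BP[zSy r] /B'P zS].
set z := (Poly xs).[c i] in zSy zS r *; split=> //; split; last by rewrite addxC.
move=> u /addxP[w yuw].
have /zSy/addxP[w' ww'] : z *: w \in addx S y.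
  apply/addxP; exists u; rewrite -opprB; exact: memN.
apply/addxP; exists w'; apply: yS.
have -> : y *: (u - z *: w') = (y *: u - z *: w) + z *: (w - y *: w').
  by rewrite !scalerBr !scalerA [z * y]mulrC addrA subrK.
by rewrite rpredD // rpredZ.
Qed.
End OneModule.

Lemma horner_lspan (x : A) (xs : seq A) (a : A) :
  exists2 w : A, w \in lspan (xs : seq A^o) & (Poly (x :: xs)).[a] = x + w.
Proof.
exists ((Poly xs).[a] * a); last by rewrite /= horner_cons addrC.
apply: idealMr; elim: xs => [|y xs IH]; first by rewrite /= horner0; exact: ideal0.
have -> : (Poly (y :: xs)).[a] = (Poly xs).[a] * a + y by rewrite /= horner_cons.
rewrite lspan_cons; apply: idealD; last exact: addcr.
by apply: idealMr; exact: addcl.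
Qed.

(** Repeating [exchange_step] on two modules with common general elements. Each
    [z] is the sum of the first remaining generator and a combination of the
    others, so it replaces that generator. *)
Lemma exchange (U V : lmodType A) : noethM U -> noethM V ->
  forall k (S : submodClosed U) (T : submodClosed V) ys ys' xs,
  size ys = k -> size ys' = k -> (k <= size xs)%N ->
  {subset ys <= m} -> {subset ys' <= m} -> regseq S ys -> regseq T ys' ->
  parametric m S xs -> parametric m T xs ->
  exists zs xs' : seq A, [/\ size zs = k, size (zs ++ xs') = size xs,
    lspan ((zs ++ xs') : seq A^o) = lspan (xs : seq A^o), regseq S zs & regseq T zs].
Proof.
move=> Un Vn; elim=> [|k IH] S T ys ys' xs.
  by exists [::], xs.
case: ys => [//|y ys] [sy]; case: ys' => [//|y' ys'] [sy']; case: xs => [//|x xs] /= kxs.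
move=> ysm ysm' Sys Tys Sxs Txs.
have [B BP] := exchange_step Un Sxs ysm Sys.
have [B' B'P] := exchange_step Vn Txs ysm' Tys.
have [zS Sys'] := BP _ (leq_maxl B B'); have [zT Tys'] := B'P _ (leq_maxr B B').
have := horner_lspan x xs (c (maxn B B')).
set z := (Poly (x :: xs)).[_] in zS zT Sys' Tys' * => -[w wxs zE].
have E : lspan (z :: xs : seq A^o) = lspan (x :: xs : seq A^o).
  rewrite !lspan_cons; apply: sub_antiS; apply: addc_sub; try exact: addcl.
    by rewrite zE; apply: idealD; [exact: addcr | exact: addcl].
  have -> : x = z - w by rewrite zE addrK.
  by apply: idealB; [exact: addcr | exact: addcl].
have par (W : lmodType A) (R : submodClosed W) :
    parametric m R (x :: xs) -> parametric m (addx R z) xs.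
  move=> h a /h[n [e []]]; rewrite -E lspan_cons => /addcP[b eb] eR.
  exists n, (e - b * z); split=> // u; apply/addxP; exists (b *: u).
  rewrite scalerA -scalerBl.
  have -> : a ^+ n - (e - b * z) - z * b = a ^+ n - e by ring.
  exact: eR.
have mbelast t (ts : seq A) : {subset t :: ts <= m} -> {subset belast t ts <= m}.
  by move=> h a /mem_belast/h.
have [zs [xs' [s1 s2 s3 s4 s5]]] := IH _ _ _ _ xs (etrans (size_belast _ _) sy)
  (etrans (size_belast _ _) sy') kxs (mbelast _ _ ysm) (mbelast _ _ ysm')
  Sys' Tys' (par _ _ Sxs) (par _ _ Txs).
exists (z :: zs), xs'; split=> //=; rewrite ?s1 ?s2 //.
by rewrite -E (lspan_cons (z : A^o) (zs ++ xs')) s3 -lspan_cons.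
Qed.
End General.

(** * Chains of submodules and lengths *)

Section Chains.
Variables (A : comNzRingType) (U : lmodType A).
Implicit Types (S T W N : submodClosed U).

(** Strict chains from [S] to [T], as an inductive predicate of their top and
    their length: the arguments below add one submodule at a time. *)
Inductive has_chain S : submodClosed U -> nat -> Prop :=
| HasChain0 T : {subset S <= T} -> has_chain S T 0
| HasChainS T T' k : has_chain S T k -> properS T T' -> has_chain S T' k.+1.

Definition chain_le S T c := forall k, has_chain S T k -> (k <= c)%N.
Definition is_len S T l := is_max (has_chain S T) l.

Lemma chain_sub S T k : has_chain S T k -> {subset S <= T}.
Proof. by elim=> // T1 T' j _ ST1 [T1T' _] x /ST1/T1T'. Qed.

Lemma chain_monor S T T' k :
  has_chain S T k -> {subset T <= T'} -> has_chain S T' k.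
Proof.
case=> [T1 ST1|T1 T2 j c [T12 [x xT2 xT1]]] TT'.
  by apply: HasChain0 => y /ST1/TT'.
apply: HasChainS c _; split; first by move=> y /T12/TT'.
by exists x => //; exact: TT'.
Qed.

Lemma chain_monol S S' T k :
  {subset S' <= S} -> has_chain S T k -> has_chain S' T k.
Proof.
move=> SS'; elim=> [T1 ST1|T1 T2 j _ IH p]; last exact: HasChainS IH p.
by apply: HasChain0 => x /SS'/ST1.
Qed.

Lemma chain_cat S T W a b :
  has_chain S T a -> has_chain T W b -> has_chain S W (a + b).
Proof.
move=> ca; elim=> [W1 TW1|W1 W2 j _ IH p]; first by rewrite addn0; exact: chain_monor ca TW1.
by rewrite addnS; exact: HasChainS IH p.
Qed.

Fact capS_lin S T : lin_closed (fun u => u \in S /\ u \in T).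
Proof.
split; first by rewrite !rpred0.
by move=> a u v [uS uT] [vS vT]; split; apply: rpredD => //; exact: rpredZ.
Qed.
Definition capS S T := mkS (capS_lin S T).
Lemma capSP S T u : u \in capS S T <-> u \in S /\ u \in T.
Proof. exact: mkSP. Qed.

(** Modular law: each strict inclusion [N < N'] stays strict after intersection
    with [T] or after addition of [T]. *)
Lemma chain_split S T N k : {subset S <= T} -> has_chain S N k ->
  exists i j, [/\ has_chain S (capS N T) i, has_chain T (addS N T) j & (k <= i + j)%N].
Proof.
move=> ST; elim=> [N1 SN1|N1 N2 j _ [a [b [ca cb kab]]] [N12 [x x2 x1]]].
  exists 0%N, 0%N; split=> //; apply: HasChain0; last exact: addSr.
  by move=> x xS; apply/capSP; split; [exact: SN1 | exact: ST].
have cap12 : {subset capS N1 T <= capS N2 T}.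
  by move=> y /capSP[/N12 y2 yT]; apply/capSP.
have add12 : {subset addS N1 T <= addS N2 T}.
  by apply: addS_sub => [y /N12|]; [exact: addSl | exact: addSr].
have [[y [yN2 yT yN1]]|no] := EM (exists y, [/\ y \in N2, y \in T & y \notin N1]).
  exists a.+1, b; split; last by rewrite addSn.
  - apply: HasChainS ca _; split=> //; exists y; first by apply/capSP.
    by apply/negP => /capSP[]; rewrite (negPf yN1).
  - exact: chain_monor cb add12.
exists a, b.+1; split; last by rewrite addnS.
- exact: chain_monor ca cap12.
- apply: HasChainS cb _; split=> //; exists x; first exact: addSl.
  apply/negP => /addSP[t tT xt]; apply: no; exists t; split=> //.
    by rewrite -(subKr x t) memB //; exact: N12.
  by apply: contraNN x1 => tN1; rewrite -(subrK t x) rpredD.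
Qed.

Lemma chain_le_add S T W a b : {subset S <= T} -> {subset T <= W} ->
  chain_le S T a -> chain_le T W b -> chain_le S W (a + b).
Proof.
move=> ST TW Sa Tb k /(chain_split ST)[i [j [ci cj kij]]].
apply: leq_trans kij _; apply: leq_add; [apply: Sa | apply: Tb].
  by apply: chain_monor ci _ => x /capSP[].
by apply: chain_monor cj _; exact: addS_sub.
Qed.

Lemma is_len_add S T W a b :
  is_len S T a -> is_len T W b -> is_len S W (a + b).
Proof.
move=> [ca la] [cb lb]; split; first exact: chain_cat ca cb.
exact: chain_le_add (chain_sub ca) (chain_sub cb) la lb.
Qed.

Lemma is_len0 S : is_len S S 0.
Proof.
split; first exact: HasChain0.
suff h T k : has_chain S T k -> {subset T <= S} -> k = 0%N by move=> j /h h0; rewrite h0.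
by case=> // T1 T2 {}k /chain_sub ST1 [_ [x xT2 xT1]] /(_ x xT2)/ST1; rewrite (negPf xT1).
Qed.

Lemma is_len_uniq S T a b : is_len S T a -> is_len S T b -> a = b.
Proof. by move=> [ca la] [cb lb]; apply/eqP; rewrite eqn_leq la // lb. Qed.

Lemma bounded_len S T c : {subset S <= T} -> chain_le S T c -> exists l, is_len S T l.
Proof.
move=> ST le_c; have ex : exists l, `[< has_chain S T l >].
  by exists 0%N; apply/asboolP/HasChain0.
have [|l /asboolP cl lmax] := ex_maxnP ex (m := c); first by move=> k /asboolP/le_c.
by exists l; split=> // j /asboolP/lmax.
Qed.

Lemma strict_chainP k :
  (exists N : nat -> submodClosed U, strict_chain N k) <->
  has_chain zeroS (fullS : submodClosed U) k.
Proof.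
split=> [[N Nk]|].
  suff : has_chain zeroS (N k) k by move/chain_monor; apply.
  elim: k Nk => [|k IH] Nk.
    by apply: HasChain0 => x /zeroSP ->; exact: rpred0.
  apply: HasChainS (Nk k _) => //; apply: IH => i ik; apply: Nk.
  exact: ltnW.
suff h T : has_chain zeroS T k -> exists N : nat -> submodClosed U, strict_chain N k /\ N k = T.
  by move=> /h[N [Nk _]]; exists N.
elim=> [T1 _|T1 T2 j _ [N [Nj NT1]] p]; first by exists (fun=> T1).
exists (fun i => if (i <= j)%N then N i else T2); split; last by rewrite ltnn.
move=> i; rewrite ltnS => ij /=; rewrite ij.
have [ij'|ji] := ltnP i j; first exact: Nj.
by have -> : i = j by [apply/eqP; rewrite eqn_leq ij]; rewrite NT1.
Qed.

Lemma has_lengthP l : has_length U l <-> is_len zeroS (fullS : submodClosed U) l.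
Proof.
rewrite /has_length /is_len /is_max.
by split=> -[/strict_chainP c h]; split=> // j /strict_chainP/h.
Qed.
End Chains.

(** Intervals of submodules that a linear map puts in bijection *)
Section ChainMap.
Variables (A : comNzRingType) (U V : lmodType A) (f : {linear U -> V}).
Variables (S T : submodClosed U) (S' T' : submodClosed V).
Hypothesis fS : forall u, u \in S -> f u \in S'.

Lemma chain_image k N : (forall u, u \in T -> f u \in S' -> u \in S) ->
  has_chain S N k -> {subset N <= T} -> has_chain S' (addS S' (imS f N)) k.
Proof.
move=> Sf; elim=> [N1 _ _|N1 N2 j c IH [N12 [x x2 x1]] N2T].
  by apply: HasChain0; exact: addSl.
have N1T : {subset N1 <= T} by move=> y /N12/N2T.
apply: HasChainS (IH N1T) _; split.
  apply: addS_sub; first exact: addSl.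
  by move=> _ /imSP[u uN <-]; apply/addSr/imSP; exists u => //; exact: N12.
exists (f x); first by apply/addSr/imSP; exists x.
apply/negP => /addSP[_ /imSP[u u1 <-]]; rewrite -linearB => /Sf h.
move/negP: x1; apply; rewrite -(subrK u x) rpredD //.
by apply: (chain_sub c); apply: h; rewrite memB //; [exact: N2T | exact: N1T].
Qed.

Lemma chain_preim k N : {subset T' <= addS S' (imS f T)} -> {subset S <= T} ->
  has_chain S' N k -> {subset N <= T'} -> has_chain S (capS (preS f N) T) k.
Proof.
move=> T'f ST; elim=> [N1 S'N1 _|N1 N2 j c IH [N12 [y y2 y1]] N2T'].
  by apply: HasChain0 => u uS; apply/capSP; split; [apply/preSP/S'N1/fS | exact: ST].
have N1T' : {subset N1 <= T'} by move=> z /N12/N2T'.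
apply: HasChainS (IH N1T') _; split.
  by move=> u /capSP[/preSP/N12 u2 uT]; apply/capSP; split=> //; apply/preSP.
have /T'f/addSP[_ /imSP[u uT <-] yu] := N2T' _ y2.
have {}yu : y - f u \in N1 by apply: chain_sub c _ yu.
exists u.
  apply/capSP; split=> //; apply/preSP.
  by rewrite -(subKr y (f u)) memB //; exact: N12.
by apply: contraNN y1 => /capSP[/preSP fu _]; rewrite -(subrK (f u) y) rpredD.
Qed.

Hypotheses (ST : {subset S <= T}) (ST' : {subset S' <= T'}).
Hypothesis fT : forall u, u \in T -> f u \in T'.
Hypothesis Sf : forall u, u \in T -> f u \in S' -> u \in S.
Hypothesis fsurj : forall v, v \in T' -> exists2 u, u \in T & v - f u \in S'.

Lemma chain_map k : has_chain S T k <-> has_chain S' T' k.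
Proof.
have T'f : {subset T' <= addS S' (imS f T)}.
  move=> v /fsurj[u uT vu]; apply/addSP; exists (f u) => //.
  by apply/imSP; exists u.
split=> [c|c].
  apply: (chain_monor (chain_image Sf c _)) => //; apply: addS_sub => //.
  by move=> _ /imSP[u uT <-]; exact: fT.
by apply: (chain_monor (chain_preim T'f ST c _)) => // u /capSP[].
Qed.

Lemma is_len_map l : is_len S T l <-> is_len S' T' l.
Proof.
by rewrite /is_len /is_max; split=> -[/chain_map c h]; split=> // j /chain_map/h.
Qed.
End ChainMap.

Section ChainBounds.
Variables (A : comNzRingType) (U : lmodType A).
Implicit Types (S T W N : submodClosed U) (Q : ideal A).

(** The interval from [S] to [S + A u] is an interval of [A / Q] when
    [Q u] is in [S]. *)
Lemma chain_le_cyclic Q S u c : chain_le Q fullS c ->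
  (forall q : A, q \in Q -> q *: u \in S) -> chain_le S (addc S u) c.
Proof.
move=> Qc Qu k ck; pose f : A^o -> U := fun a => (a : A) *: u.
have fl : linear f.
  by move=> a x y; rewrite /f scalerA -scalerDl.
pose F : {linear A^o -> U} := HB.pack f (GRing.isLinear.Build A A^o U *:%R f fl).
have pre := chain_preim (f := F) (S := Q) (T := fullS) (S' := S)
  (T' := addc S u) Qu _ _ ck.
apply/Qc/(chain_monor (pre _ _ _)) => //.
move=> v /addcP[a va]; apply/addSP; exists (a *: u) => //.
by apply/imSP; exists a.
Qed.

Lemma chain_le_lspan Q c : chain_le Q fullS c -> forall us S,
  (forall u, u \in us -> forall q : A, q \in Q -> q *: u \in S) ->
  chain_le S (addS S (lspan us)) (c * size us).
Proof.
move=> Qc; elim=> [|u us IH] S Qus k.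
  move=> ck; rewrite muln0; apply: (proj2 (is_len0 S)).
  by apply: chain_monor ck _; apply: addS_sub => // v /lspan_nil ->; exact: rpred0.
rewrite mulnS => ck.
apply: (chain_le_add (T := addc S u) (W := addS (addc S u) (lspan us))) => //.
- exact: addcl.
- exact: addSl.
- by apply: chain_le_cyclic Qc _ => q; apply: Qus; exact: mem_head.
- apply: IH => v vus q qQ; apply: addcl; apply: Qus => //.
  by rewrite inE vus orbT.
- apply: chain_monor ck _; apply: addS_sub; first by move=> v vS; exact/addSl/addcl.
  rewrite lspan_cons; apply: addc_sub; first exact: addSr.
  exact/addSl/addcr.
Qed.
End ChainBounds.

(** * Monomials and forms *)

Section Monomials.
Variable R : comNzRingType.
Implicit Types (xs ms cs : seq R).

(** The monomials of degree [n] in [x :: xs] are those in [xs] followed by the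
    multiples of [x]: a form of degree [n.+1] splits as [G + x H] with [G] in
    fewer variables and [H] of smaller degree, which carries every induction
    below. *)
Fixpoint mons xs : nat -> seq R :=
  if xs is x :: xs' then
    fix aux n := if n is n'.+1 then mons xs' n ++ [seq x * y | y <- aux n'] else [:: 1]
  else fun n => if n is 0 then [:: 1] else [::].

Lemma mons0 xs : mons xs 0 = [:: 1].
Proof. by case: xs. Qed.

Lemma mons_cons x xs n :
  mons (x :: xs) n.+1 = mons xs n.+1 ++ [seq x * y | y <- mons (x :: xs) n].
Proof. by []. Qed.

Lemma size_mons_nil n : size (mons [::] n) = (n == 0)%N.
Proof. by case: n. Qed.

Lemma size_mons_cons x xs n : size (mons (x :: xs) n) = 'C(n + size xs, size xs).
Proof.
elim: xs x n => [|y xs IH] x n.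
  rewrite bin0; elim: n => [|n IHn] //.
  by rewrite mons_cons size_cat size_map IHn.
elim: n => [|n IHn]; first by rewrite mons0 add0n binn.
by rewrite mons_cons size_cat size_map IHn IH /= [in RHS]addSn binS addnC addSnnS.
Qed.

Fixpoint dot cs ms : R :=
  match cs, ms with c :: cs', y :: ms' => c * y + dot cs' ms' | _, _ => 0 end.

Lemma dot_cat cs ms cs' ms' : size cs = size ms ->
  dot (cs ++ cs') (ms ++ ms') = dot cs ms + dot cs' ms'.
Proof.
elim: cs ms => [|c cs IH] [|y ms] //=; first by rewrite add0r.
by case=> /IH ->; rewrite addrA.
Qed.

Lemma dot_scale x cs ms : dot cs [seq x * y | y <- ms] = x * dot cs ms.
Proof.
elim: cs ms => [|c cs IH] [|y ms]; rewrite /= ?mulr0 //.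
by rewrite IH; ring.
Qed.

Lemma dot_scalel x cs ms : dot [seq x * y | y <- cs] ms = x * dot cs ms.
Proof.
elim: cs ms => [|c cs IH] [|y ms]; rewrite /= ?mulr0 //.
by rewrite IH; ring.
Qed.

Lemma dot_split x xs n cs : size cs = size (mons (x :: xs) n.+1) ->
  let k := size (mons xs n.+1) in
  [/\ size (take k cs) = size (mons xs n.+1), size (drop k cs) = size (mons (x :: xs) n)
    & dot cs (mons (x :: xs) n.+1) =
      dot (take k cs) (mons xs n.+1) + x * dot (drop k cs) (mons (x :: xs) n)].
Proof.
rewrite mons_cons size_cat size_map => s /=.
have s1 : size (take (size (mons xs n.+1)) cs) = size (mons xs n.+1).
  by rewrite size_takel // s leq_addr.
split=> //; first by rewrite size_drop s addKn.
by rewrite -[in LHS](cat_take_drop (size (mons xs n.+1)) cs) dot_cat // dot_scale.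
Qed.

Lemma dot_sum (c : nat -> R) ms :
  dot (mkseq c (size ms)) ms = \sum_(i < size ms) c i * ms`_i.
Proof.
elim: ms c => [|y ms IH] c; first by rewrite big_ord0.
by rewrite /= big_ord_recl /= -(IH (c \o S)) (iotaDl 1) -map_comp.
Qed.
End Monomials.

Lemma size_mons_eq (R R' : comNzRingType) (xs : seq R) (ys : seq R') n :
  size xs = size ys -> size (mons xs n) = size (mons ys n).
Proof.
case: xs ys => [|x xs] [|y ys] // => [_|[E]]; first by rewrite !size_mons_nil.
by rewrite !size_mons_cons E.
Qed.

Section MonMorph.
Variables (R R' : comNzRingType) (f : {rmorphism R -> R'}).
Lemma mons_morph xs n : map f (mons xs n) = mons (map f xs) n.
Proof.
elim: xs n => [|x xs IH]; first by case=> [|n] //=; rewrite rmorph1.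
elim=> [|n IHn]; first by rewrite /= rmorph1.
rewrite map_cons !mons_cons map_cat IH -map_cons -IHn -!map_comp; congr (_ ++ _).
by apply: eq_map => y /=; rewrite rmorphM.
Qed.
Lemma dot_morph cs ms : f (dot cs ms) = dot (map f cs) (map f ms).
Proof.
elim: cs ms => [|c cs IH] [|y ms]; rewrite /= ?rmorph0 //.
by rewrite rmorphD rmorphM IH.
Qed.
End MonMorph.

Section MonIdeal.
Variable A : comNzRingType.
Implicit Types (I J K : ideal A) (xs ms cs : seq A).

Lemma mons_scale (a : A) xs n : mons [seq a * x | x <- xs] n = [seq a ^+ n * y | y <- mons xs n].
Proof.
elim: xs n => [|x xs IH]; first by case=> [|n] //=; rewrite expr0 mul1r.
elim=> [|n IHn]; first by rewrite /= expr0 mul1r.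
rewrite map_cons !mons_cons map_cat IH -map_cons IHn -!map_comp; congr (_ ++ _).
by apply: eq_map => y /=; rewrite exprS; ring.
Qed.

Lemma lspan_dot ms (v : A) :
  v \in lspan (ms : seq A^o) <-> exists2 cs, size cs = size ms & v = dot cs ms.
Proof.
elim: ms v => [|y ms IH] v.
  split=> [/lspan_nil ->|[[|//] _ ->]]; first by exists [::].
  exact: ideal0.
rewrite lspan_cons; split=> [/addcP[a /IH[cs s E]]|[[//|c cs] /= [s] ->]].
  by exists (a :: cs); rewrite /= ?s // -E addrC subrK.
apply/addcP; exists c; apply/IH; exists cs => //.
by rewrite -[c *: (y : A^o)]/(c * y) addrC addKr.
Qed.

(** In ideals, the splitting of forms as [G + x H]. *)
Lemma idealX_addc K (x : A) n : let J := addc K x in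
  idealX J n.+1 = addS (idealX K n.+1) (imS (GRing.scale x : {linear A^o -> A^o}) (idealX J n)).
Proof.
move=> J; have KJ : {subset K <= J} by exact: addcl.
have xJ : x \in J by exact: addcr.
apply: sub_antiS; last first.
  apply: addS_sub; first exact: idealX_mono.
  by move=> _ /imSP[u uJ <-]; exact: (mulS_mem (U := A^o)).
have JE n' : {subset idealX J n'.+1 <= addS (mulS K (idealX J n'))
    (imS (GRing.scale x : {linear A^o -> A^o}) (idealX J n'))}.
  apply: mulS_sub => a u /addcP[b ab] uJ; apply/addSP; exists (x * (b * u)).
    by apply/imSP; exists (b * u) => //; exact: idealM.
  have -> : a *: u - x * (b * u) = (a - b * x) *: u.
    by rewrite /GRing.scale /=; ring.
  exact: mulS_mem.
elim: n => [|n IH] v /JE; apply: addS_sub; try exact: addSr.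
  by move=> y yK; apply: addSl.
apply: mulS_sub => a u aK /IH/addSP[_ /imSP[w wJ <-] uw].
apply/addSP; exists (x * (a * w)).
  apply/imSP; exists (a * w) => //; apply: (mulS_mem (U := A^o)) => //; exact: KJ.
have -> : a *: u - x * (a * w) = a *: (u - x *: w).
  by rewrite /GRing.scale /=; ring.
exact: (mulS_mem (U := A^o)).
Qed.

Lemma lspan_map (U V : lmodType A) (f : {linear U -> V}) (us : seq U) :
  lspan (map f us) = imS f (lspan us).
Proof.
apply: sub_antiS.
  apply: lspan_sub => _ /mapP[u uus ->]; apply/imSP; exists u => //.
  exact: mem_lspan.
move=> _ /imSP[u uus <-]; apply/preSP; move: u uus.
by apply: lspan_sub => u uus; apply/preSP/mem_lspan/map_f.
Qed.

Lemma lspan_mons xs n : lspan (mons xs n : seq A^o) = idealX (lspan (xs : seq A^o)) n.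
Proof.
have E0 (ys : seq A) : lspan (mons ys 0 : seq A^o) = fullS.
  rewrite mons0; apply: sub_antiS => // x _; rewrite lspan_cons.
  by apply/addcP; exists x; rewrite [x *: _]mulr1 subrr rpred0.
elim: xs n => [|x xs IH]; case=> [|n] //; rewrite ?E0 //.
  have -> : mons [::] n.+1 = [::] :> seq A by [].
  apply: sub_antiS; first by move=> y /lspan_nil ->; exact: rpred0.
  apply: mulS_sub => a u /lspan_nil -> _; rewrite scale0r; exact: rpred0.
elim: n => [|n IHn]; rewrite mons_cons lspan_cat IH
    (lspan_map (GRing.scale x : {linear A^o -> A^o})) ?IHn ?E0;
  rewrite !lspan_cons; exact/esym/idealX_addc.
Qed.
End MonIdeal.

(** * Minimal reductions are generated by [d] elements *)

Section FormValues.
Variables (A : comNzRingType) (m : ideal A).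
Hypotheses (A_noeth : noetherian A) (A_local : local_ring m).
Variable (c : nat -> A).
Hypothesis cP : forall i j, i != j -> c i - c j \notin m.

(** A nonzero form over the infinite residue field has a nonzero value. Choose
    values for the other variables that keep some power of the first variable
    alive, then a general value of the first variable. *)
Lemma form_value s e cs : size cs = size (mons (nseq s (0 : A)) e) ->
  ~ {subset cs <= m} -> exists2 ls, size ls = s & dot cs (mons ls e) \notin m.
Proof.
have size1 (b : seq A) : size b = 1%N -> ~ {subset b <= m} ->
    exists2 z, b = [:: z] & z \notin m.
  case: b => [|z []] // _ bm; exists z => //; apply/negP => zm; apply: bm => y.
  by rewrite inE => /eqP ->.
elim: s e cs => [|s IH] e cs.
  case: e => [|e] /=; last by case: cs => // _ [].
  move=> /size1 h /h[z -> zm]; exists [::] => //=.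
  by rewrite mulr1 addr0.
move=> scs csm.
have [ls sls [j jP]] : exists2 ls, size ls = s & exists j,
    (dot (map polyC cs) (mons ('X :: map polyC ls) e))`_j \notin m.
  elim: e cs scs csm => [|e IHe] cs scs csm.
    have [z -> zm] := size1 cs scs csm; exists (nseq s 0); rewrite ?size_nseq //.
    by exists 0%N; rewrite /= mulr1 addr0 coefC.
  have [] := @dot_split _ 0 (nseq s 0) e cs scs.
  set k := size (mons (nseq s 0) e.+1) => s1 s2 _.
  have cut ls : size ls = s -> dot (map polyC cs) (mons ('X :: map polyC ls) e.+1) =
      (dot (take k cs) (mons ls e.+1))%:P +
      'X * dot (map polyC (drop k cs)) (mons ('X :: map polyC ls) e).
    move=> sls; have [|_ _ ->] := @dot_split _ 'X (map polyC ls) e (map polyC cs).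
      rewrite size_map scs; apply: size_mons_eq.
      by rewrite /= size_nseq size_map sls.
    have -> : size (mons (map polyC ls) e.+1) = k.
      by rewrite /k; apply: size_mons_eq; rewrite size_nseq size_map.
    by rewrite -map_take -map_drop dot_morph (mons_morph polyC).
  have [dm|dm] := EM {subset drop k cs <= m}; last first.
    have [ls sls [j jP]] := IHe _ s2 dm; exists ls => //; exists j.+1.
    by rewrite cut // coefD coefC add0r coefXM.
  have [|ls sls lsP] := IH e.+1 (take k cs) s1.
    move=> tm; apply: csm => z; rewrite -(cat_take_drop k cs) mem_cat.
    by case/orP => [/tm|/dm].
  by exists ls => //; exists 0%N; rewrite cut // coefD coefC coefXM addr0.
have [|B BP] := @poly_eventually _ m A_noeth A_local c cP m
  (dot (map polyC cs) (mons ('X :: map polyC ls) e)).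
  by move=> h; rewrite h in jP.
exists (c B :: ls); first by rewrite /= sls.
have := BP B (leqnn B).
rewrite -[_.[_]]/(horner_eval (c B) _) dot_morph (mons_morph (horner_eval (c B))).
have E : horner_eval (c B) \o polyC =1 id by move=> z; rewrite /= /horner_eval hornerC.
rewrite map_cons -!map_comp !(eq_map E) !map_id.
by rewrite [in X in _ -> X](_ : c B = 'X.[c B]); last by rewrite hornerX.
Qed.
End FormValues.

Section FormCongruence.
Variables (A : comNzRingType).
Implicit Types (I J K : ideal A) (xs ms cs : seq A).

(** Values of a form of degree [n] at points of [J] congruent modulo [K] differ
    by an element of [K J ^ (n - 1)]. *)
Definition congr_deg K J n : ideal A := if n is n'.+1 then mulS K (idealX J n') else zeroS.

Lemma dot_idealX J xs n cs : {subset xs <= J} -> dot cs (mons xs n) \in idealX J n.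
Proof.
move=> xsJ; have : dot cs (mons xs n) \in lspan (mons xs n : seq A^o).
  elim: cs (mons xs n) => [|c cs IH] [|y ms]; rewrite ?ideal0 //.
  rewrite lspan_cons [dot _ _]/=; apply: idealD; first exact/idealM/addcr.
  exact/addcl/IH.
by rewrite lspan_mons; apply: idealX_mono; exact: lspan_sub.
Qed.

Lemma form_congr K J us vs n cs : size us = size vs -> size cs = size (mons us n) ->
  {subset us <= J} -> {subset vs <= J} ->
  (forall i, us`_i - vs`_i \in K) ->
  dot cs (mons us n) - dot cs (mons vs n) \in congr_deg K J n.
Proof.
elim: us vs n cs => [|u us IH] [|v vs] // n cs; first by rewrite subrr ideal0.
move=> [suv] scs uJ vJ uvK.
elim: n cs scs => [|n IHn] cs scs; first by rewrite subrr ideal0.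
have scs' : size cs = size (mons (v :: vs) n.+1).
  by rewrite scs; apply: size_mons_eq; rewrite /= suv.
have [s1 s2 ->] := dot_split scs; have [_ _ ->] := dot_split scs'.
rewrite (size_mons_eq n.+1 (esym suv)).
set c1 := take _ cs; set c2 := drop _ cs.
set G := dot c1 _; set G' := dot c1 _; set H := dot c2 _; set H' := dot c2 _.
have -> : G + u * H - (G' + v * H') = (G - G') + ((u - v) * H + v * (H - H')) by ring.
apply: idealD.
  apply: IH => //; first by move=> x xus; apply: uJ; rewrite inE xus orbT.
    by move=> x xvs; apply: vJ; rewrite inE xvs orbT.
  by move=> i; have := uvK i.+1.
apply: idealD.
  apply: (mulS_mem (U := A^o)); first exact: (uvK 0%N).
  exact: dot_idealX.
have : H - H' \in congr_deg K J n by exact: IHn.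
case: (n) => [|k]; first by move=> /zeroSP ->; rewrite mulr0 ideal0.
have -> : congr_deg K J k.+2 = mulS J (mulS K (idealX J k)) by exact: mulSCA.
move=> h.
by apply: (mulS_mem (U := A^o)) => //; apply: vJ; exact: mem_head.
Qed.
End FormCongruence.

Section Reduction.
Variables (A : comNzRingType) (m : ideal A).
Hypotheses (A_noeth : noetherian A) (A_local : local_ring m).
Variable (c : nat -> A).
Hypothesis cP : forall i j, i != j -> c i - c j \notin m.
Variables (I J : ideal A) (k : nat).
Hypotheses (J_min : minimal_reduction J I) (J_red : reduction_from J I k).

Lemma reduction_pow n e : (k <= n)%N -> idealX I (e + n) = mulS (idealX J e) (idealX I n).
Proof.
move=> kn; elim: e => [|e IH]; first by rewrite /= mul1S.
have /submod_ext := J_red (n := (e + n)%N) (leq_trans kn (leq_addl _ _)).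
by rewrite addSn => <-; rewrite IH mulSA.
Qed.

Lemma idealX_addc_top (K : ideal A) (x : A) n :
  {subset idealX (addc K x) n.+1 <=
    addS (mulS K (idealX (addc K x) n)) (lspan ([:: x ^+ n.+1] : seq A^o))}.
Proof.
elim: n => [|n IH].
  move=> y; rewrite idealX1 => /addcP[a ya]; apply/addSP; exists (a * x).
    by rewrite lspan_cons expr1; apply/addcP; exists a; rewrite subrr ideal0.
  by rewrite mulSC mul1S.
apply: mulS_sub => a u aJ /IH/addSP[t]; rewrite !lspan_cons.
move=> /addcP[b /lspan_nil/eqP]; rewrite subr_eq0 => /eqP -> ut.
move/addcP: (aJ) => [a' aa'].
apply/addSP; exists (a' * b * x ^+ n.+2).
  by apply/addcP; exists (a' * b); rewrite subrr ideal0.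
have -> : a *: u - a' * b * x ^+ n.+2 =
    a * (u - b * x ^+ n.+1) + (a - a' * x) * (b * x ^+ n.+1).
  by rewrite /GRing.scale /= [x ^+ n.+2]exprS; ring.
apply: idealD.
  by rewrite [idealX _ n.+1]/(mulS _ (idealX _ n)) mulSCA; exact: (mulS_mem (U := A^o)).
apply: (mulS_mem (U := A^o)) => //; apply: idealM; apply: idealX_mem; exact: addcr.
Qed.

(** A form in the generators that lies in [m I ^ e] without all its
    coefficients being in [m] makes one generator integral over the others, up
    to a linear change of generators: the minimal reduction has fewer
    generators. *)
Lemma fewer_generators xs e cs : lspan (xs : seq A^o) = J ->
  size cs = size (mons xs e) -> ~ {subset cs <= m} ->
  dot cs (mons xs e) \in mulS m (idealX I e) ->
  exists2 ys, (size ys < size xs)%N & lspan (ys : seq A^o) = J.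
Proof.
move=> xsJ scs csm dcs.
have JI : {subset J <= I} by case: J_min => [[]].
have [|ls sls lsP] := form_value A_noeth A_local cP (s := size xs) (e := e) _ csm.
  by rewrite scs; apply: size_mons_eq; rewrite size_nseq.
case: e scs dcs lsP => [|e].
  rewrite !mons0 => s; rewrite mulSC mul1S.
  by move=> ->.
move=> scs dcs lsP.
have [j jls jm] : exists2 j, (j < size ls)%N & ls`_j \notin m.
  apply: contrapT => no; move/negP: lsP; apply.
  have lsm : {subset ls <= m}.
    move=> l lls; apply: contrapT => /negP lm; apply: no.
    by exists (index l ls); rewrite ?index_mem ?nth_index.
  have := dot_idealX e.+1 cs lsm; exact: mulS_subl.
set a := ls`_j in jm; set x := xs`_j; set la := dot _ _ in lsP.
have xxs : x \in xs by rewrite mem_nth // -sls.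
have mJ y : y \in xs -> y \in J by move=> yxs; rewrite -xsJ; exact: mem_lspan.
(* Linear forms vanishing at the point [ls]: modulo them [a xs] is [x ls], so
   that [a ^ (e + 1)] times the form becomes [la x ^ (e + 1)]. The form for [x]
   is zero. *)
pose bs := [seq a * p.1 - p.2 * x | p <- zip xs ls].
have sbs : size bs = size xs by rewrite size_map size_zip sls minnn.
have nbs i : bs`_i = a * xs`_i - ls`_i * x.
  have [ixs|xsi] := ltnP i (size xs); last first.
    by rewrite !nth_default ?sls ?sbs // mulr0 mul0r subrr.
  by rewrite (nth_map (0, 0)) ?size_zip ?sls ?minnn // nth_zip.
pose K : ideal A := lspan (bs : seq A^o).
have bK i : bs`_i \in K.
  have [ixs|xsi] := ltnP i (size bs); first by apply: mem_lspan; rewrite mem_nth.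
  by rewrite nth_default // ideal0.
have KJ : {subset K <= J}.
  apply: lspan_sub => b /(nthP 0)[i isz <-]; rewrite nbs.
  apply: idealB; apply: idealM; last exact: mJ.
  by apply/mJ/mem_nth; rewrite -sbs.
have JE : J = addc K x.
  apply: sub_antiS; last by apply: addc_sub => //; exact: mJ.
  rewrite -xsJ; apply: lspan_sub => y /(nthP 0)[i isz <-].
  apply: (unit_mem A_noeth A_local jm).
  have -> : a *: (xs`_i : A^o) = bs`_i + ls`_i * x by rewrite nbs subrK.
  by apply: idealD; [apply: addcl | apply: idealM; exact: addcr].
have xe : x ^+ e.+1 \in addS (mulS K (idealX J e)) (mulS m (idealX I e.+1)).
  apply: (unit_mem A_noeth A_local (U := A^o) lsP).
  pose us := [seq a * y | y <- xs]; pose vs := [seq x * l | l <- ls].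
  have : dot cs (mons us e.+1) - dot cs (mons vs e.+1) \in mulS K (idealX J e).
    apply: (form_congr (n := e.+1)).
    - by rewrite !size_map.
    - by rewrite scs; apply: size_mons_eq; rewrite size_map.
    - by move=> _ /mapP[y yxs ->]; exact/idealM/mJ.
    - by move=> _ /mapP[y yls ->]; exact/idealMr/mJ.
    move=> i; have [ixs|xsi] := ltnP i (size xs).
      by rewrite !(nth_map 0) ?sls // [x * _]mulrC -nbs.
    by rewrite !nth_default ?size_map ?sls // subrr ideal0.
  rewrite !mons_scale !dot_scale => h.
  have -> : la *: (x ^+ e.+1 : A^o) = a ^+ e.+1 * dot cs (mons xs e.+1) -
      (a ^+ e.+1 * dot cs (mons xs e.+1) - x ^+ e.+1 * la) by rewrite subKr mulrC.
  by apply: idealB; [apply/addSr/idealM | apply: addSl].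
have redK n : (k <= n)%N -> mulS K (idealX I (e + n)) =i idealX I (e + n).+1.
  move=> kn; apply: sub_mem_eq.
    by apply: mulS_mono => // y /KJ/JI.
  have [ts tsE] := noethA A_noeth (idealX I (e + n).+1).
  rewrite {1}tsE; apply: (nakayama A_noeth A_local); rewrite -tsE.
  rewrite -addSn (reduction_pow _ kn).
  apply: mulS_sub => b u; rewrite {1}JE => /idealX_addc_top/addSP[t].
  rewrite lspan_cons => /addcP[b' /lspan_nil/eqP]; rewrite subr_eq0 => /eqP ->.
  rewrite -JE => bt un.
  have -> : b *: u = (b - b' * x ^+ e.+1) * u + (b' * u) * x ^+ e.+1.
    by rewrite /GRing.scale /=; ring.
  have KE : mulS (mulS K (idealX J e)) (idealX I n) = mulS K (idealX I (e + n)).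
    by rewrite -mulSA (reduction_pow _ kn).
  apply: idealD.
    by apply: addSl; rewrite -KE; exact: (mulS_mem (U := A^o)).
  rewrite mulrAC -mulrA; apply: idealM.
  have /addSP[w wm xw] := xe.
  have -> : x ^+ e.+1 * u = (x ^+ e.+1 - w) * u + w * u by ring.
  apply: idealD.
    by apply: addSl; rewrite -KE; exact: (mulS_mem (U := A^o)).
  apply: addSr; rewrite -(reduction_pow e.+1 kn) idealXD mulSA.
  exact: (mulS_mem (U := A^o)).
have KJeq : K = J.
  apply: submod_ext; apply: (proj2 J_min) => //; split; first by move=> y /KJ/JI.
  exists (e + k)%N => n ekn; rewrite -(subnKC ekn) -addnA; apply: redK; exact: leq_addr.
have b0 : 0 \in bs.
  have -> : 0 = bs`_j by rewrite nbs /x subrr.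
  by rewrite mem_nth // sbs -sls.
exists (rem 0 bs).
  by rewrite size_rem // sbs -sls prednK // (leq_ltn_trans _ jls).
rewrite -KJeq; apply: sub_antiS; first exact/lspan_mono/mem_rem.
apply: lspan_sub => b bbs; have [->|b_neq] := eqVneq b 0; first exact: ideal0.
apply: mem_lspan; move: bbs; rewrite (perm_mem (perm_to_rem b0)) inE.
by rewrite (negPf b_neq).
Qed.

End Reduction.

Section LengthBounds.
Variables (A : comNzRingType) (m : ideal A).
Hypotheses (A_noeth : noetherian A) (A_local : local_ring m).

(** The head is not in [S], and the tail remains independent modulo [S] and the
    head. *)
Lemma independent_chain (S : ideal A) ms :
  (forall cs, size cs = size ms -> dot cs ms \in S -> {subset cs <= m}) ->
  has_chain S (addS S (lspan (ms : seq A^o))) (size ms).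
Proof.
elim: ms S => [|y ms IH] S ind; first by apply: HasChain0; exact: addSl.
have yS : y \notin S.
  apply/negP => yS; apply: (negP (max1 A_local)).
  apply: (ind (1 :: nseq (size ms) 0)); rewrite ?mem_head //= ?size_nseq //.
  rewrite mul1r; have -> : dot (nseq (size ms) 0) ms = 0; last by rewrite addr0.
  by elim: (ms) => //= z ms' ->; rewrite mul0r addr0.
have step : has_chain S (addc S y) 1.
  apply: (HasChainS (T := S)); first exact: HasChain0.
  by split; [exact: addcl | exists y => //; exact: addcr].
rewrite -[size _]/(1 + size ms)%N; apply: chain_cat step _.
apply: chain_monor (IH (addc S y) _) _.
  move=> cs scs /addcP[a h] z zcs; apply: (ind (- a :: cs)); rewrite /= ?scs //.
    by rewrite mulNr addrC.
  by rewrite inE zcs orbT.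
rewrite lspan_cons; apply: addS_sub.
  by apply: addc_sub; [exact: addSl | apply/addSr/addcr].
by move=> z zms; apply/addSr/addcl.
Qed.

(** The chains found in each [I ^ e / m I ^ e] add up. *)
Lemma power_chain (I : ideal A) (ms : nat -> seq A) N : {subset I <= m} ->
  (forall e, {subset ms e <= idealX I e}) ->
  (forall e cs, size cs = size (ms e) -> dot cs (ms e) \in mulS m (idealX I e) ->
    {subset cs <= m}) ->
  has_chain (idealX I N) (fullS : ideal A) (\sum_(e < N) size (ms e)).
Proof.
move=> Im msI ind; elim: N => [|N IH]; first by rewrite big_ord0; apply: HasChain0.
rewrite big_ord_recr /= addnC; apply: chain_cat IH.
apply: (chain_monol (S := mulS m (idealX I N))).
  by apply: mulS_mono.
apply: chain_monor (independent_chain (ind N)) _.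
apply: addS_sub; first exact: mulS_subr.
by apply: lspan_sub => x /msI.
Qed.

Lemma chain_le_max : chain_le m (fullS : ideal A) 1.
Proof.
suff h T k : has_chain m T k -> (k <= 1)%N /\ (k = 1%N -> (1 : A) \in T).
  by move=> k /h[].
elim=> [//|T1 T2 j ch [j1 h] [T12 [x x2 x1]]].
have j0 : j = 0%N.
  case: j j1 h ch => [//|[|//]] _ h _; have T11 := h erefl.
  by move: x1; rewrite -[x]mulr1 (idealM x T11).
split=> [|_]; first by rewrite j0.
have xm : x \notin m by apply: contraNN x1; exact: chain_sub ch _.
by have [y <-] := unit_notin A_noeth A_local xm; exact: idealM.
Qed.

(** For a generator [x] of [m], the layers [Q + x ^ j A] down to [Q] are cyclic
    modules over [A / (Q + x A)]: induction on the number of generators of [m]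
    that are not yet in [Q]. *)
Lemma chain_le_primary (Q : ideal A) :
  (forall y, y \in m -> exists n, y ^+ n \in Q) -> exists b, chain_le Q fullS b.
Proof.
have [xs xsE] := noethA A_noeth m.
have : {subset m <= addS Q (lspan xs)} by rewrite xsE; exact: addSr.
have : forall x, x \in xs -> x \in m by move=> x /mem_lspan; rewrite xsE.
elim: xs Q {xsE} => [|x xs IH] Q xsm mQ Qm.
  exists 1%N => k ck; apply: chain_le_max; apply: chain_monol ck.
  by move=> y /mQ/addSP[t /lspan_nil ->]; rewrite subr0.
have [|||b bP] := IH (addc Q x).
- by move=> y yxs; apply: xsm; rewrite inE yxs orbT.
- move=> y /mQ; apply: addS_sub; first by move=> z zQ; apply/addSl/addcl.
  rewrite lspan_cons; apply: addc_sub; first exact: addSr.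
  exact/addSl/addcr.
- by move=> y /Qm[n yn]; exists n; exact: addcl.
have [n xn] := Qm x (xsm x (mem_head _ _)).
suff h j : chain_le Q (addc Q (x ^+ (n - j))) (b * j).
  exists (b * n)%N => k ck; apply: (h n); rewrite subnn.
  by apply: chain_monor ck _ => y _; apply/addcP; exists y; rewrite [y *: _]mulr1 subrr rpred0.
elim: j => [|j IHj].
  move=> k ck; rewrite muln0; apply: (proj2 (is_len0 Q)).
  by apply: chain_monor ck _; apply: addc_sub => //; rewrite subn0.
have sub : {subset addc Q (x ^+ (n - j)) <= addc Q (x ^+ (n - j.+1))}.
  apply: addc_sub; first exact: addcl.
  have [jn|nj] := ltnP j n.
    have -> : (n - j = (n - j.+1).+1)%N by lia.
    by rewrite exprS; apply/idealM/addcr.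
  have -> : (n - j = n - j.+1)%N by lia.
  exact: addcr.
rewrite mulnS addnC; apply: chain_le_add IHj _ => //; first exact: addcl.
move=> k ck; have := chain_le_cyclic (S := addc Q (x ^+ (n - j)))
  (u := x ^+ (n - j.+1) : A^o) bP _ (k := k).
apply; last first.
  apply: chain_monor ck _; apply: addc_sub; first by move=> y /addcl/addcl.
  exact: addcr.
move=> q /addcP[a qa]; have -> : q = (q - a *: x) + a * x by rewrite subrK.
rewrite scalerDl; apply: idealD; first by apply/addcl; rewrite [_ *: _]mulrC; exact: idealM.
rewrite -[_ *: _]mulrA; apply: idealM; rewrite -exprS.
have [jn|nj] := ltnP j n.
  have -> : ((n - j.+1).+1 = n - j)%N by lia.
  exact: addcr.
have -> : (n - j = 0)%N by lia.
by apply/addcP; exists (x ^+ (n - j.+1).+1); rewrite expr0 [_ *: _]mulr1 subrr ideal0.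
Qed.

Lemma chain_le_power (xs : seq A) b N :
  chain_le (lspan (xs : seq A^o)) (fullS : ideal A) b ->
  chain_le (idealX (lspan (xs : seq A^o)) N) (fullS : ideal A)
    (b * \sum_(e < N) size (mons xs e)).
Proof.
move=> Qb; elim: N => [|N IH].
  by rewrite big_ord0 muln0; exact: (proj2 (is_len0 _)).
rewrite big_ord_recr /= mulnDr addnC.
apply: chain_le_add IH => //; first exact: mulS_subr.
move=> k ck; apply: (chain_le_lspan (us := mons xs N : seq A^o) Qb
  (S := idealX (lspan (xs : seq A^o)) N.+1)).
  move=> u /mem_lspan; rewrite lspan_mons => uN q qQ.
  rewrite [q *: u]mulrC; rewrite -[u * q]mulrC; exact: (mulS_mem (U := A^o)).
by apply: chain_monor ck _; rewrite lspan_mons; exact: addSr.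
Qed.

End LengthBounds.

(** * Regular sequences and dimension *)

Section Dimension.
Variables (A : comNzRingType) (m : ideal A).
Hypotheses (A_noeth : noetherian A) (A_local : local_ring m).
Implicit Types (P : ideal A).

Lemma addxs_ideal (zs : seq A) : addxs (zeroS : ideal A) zs = lspan (zs : seq A^o).
Proof. by rewrite addxs_lspan mulSC mul1S. Qed.

(** An element [z] of [P] regular modulo an ideal [Q] in [P] cuts out a smaller
    prime: no product of a power of [z] and an element outside [P] is in
    [Q], so some prime containing [Q] avoids all these products. *)
Lemma regular_prime_chain zs : regseq (zeroS : ideal A) zs ->
  forall P, prime_ideal P -> {subset lspan (zs : seq A^o) <= P} ->
  exists N : nat -> ideal A, [/\ strict_chain N (size zs), N (size zs) = P &
    forall i, (i <= size zs)%N -> prime_ideal (N i)].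
Proof.
elim/last_ind: zs => [|zs z IH].
  by move=> _ P Pp _; exists (fun=> P); split.
move=> /regseq_rcons[zsr]; rewrite addxs_ideal => zr P Pp zsP.
have zP : z \in P by apply/zsP/mem_lspan; rewrite mem_rcons mem_head.
have sub : {subset lspan (zs : seq A^o) <= P}.
  move=> x xs; apply: zsP; move: x xs; apply: lspan_mono => x xzs.
  by rewrite mem_rcons inE xzs orbT.
have [||| P' [P'p zsP' XP']] := prime_exists A_noeth
  (X := fun x => exists n s, s \notin P /\ x = z ^+ n * s) (S := lspan (zs : seq A^o)).
- by exists 0%N, 1; rewrite expr0 mul1r; split=> //; case: Pp.
- move=> _ _ [n [s [sP ->]]] [k [t [tP ->]]]; exists (n + k)%N, (s * t); split.
    by apply/negP => /(proj2 Pp); rewrite (negPf sP) (negPf tP).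
  by rewrite exprD; ring.
- move=> _ [n [s [sP ->]]]; apply/negP => h; move/negP: sP; apply; apply: sub.
  elim: n h => [|n IHn]; first by rewrite expr0 mul1r.
  by rewrite exprS -mulrA => /zr/IHn.
have [N [Nc Ntop Np]] := IH zsr P' P'p zsP'.
exists (fun i => if (i <= size zs)%N then N i else P).
rewrite size_rcons ltnn; split=> // [i|i _]; last first.
  by have [/Np|] := leqP i (size zs).
rewrite ltnS => ize /=; rewrite ize.
have [ilt|ige] := ltnP i (size zs); first exact: Nc.
have -> : i = size zs by apply/eqP; rewrite eqn_leq ize.
rewrite Ntop; split.
  move=> x xP'; apply: contrapT => /negP xP; apply: (negP (XP' x _)) => //.
  by exists 0%N, x; rewrite expr0 mul1r.
exists z => //; apply: XP'; exists 1%N, 1; rewrite expr1 mulr1; split=> //.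
by case: Pp.
Qed.

(** A prime containing [zs] other than [m] would be the top of a chain of [d]
    strict inclusions, which [m] would extend beyond the dimension. *)
Lemma regular_parameters d zs : krull_dim A d -> size zs = d ->
  regseq (zeroS : ideal A) zs -> {subset lspan (zs : seq A^o) <= m} ->
  forall y, y \in m -> exists n, y ^+ n \in lspan (zs : seq A^o).
Proof.
move=> [_ dmax] szs zsr zsm y ym; apply: contrapT => no.
have [|||P [Pp zsP yP]] := prime_exists A_noeth
  (X := fun x => exists n, x = y ^+ n) (S := lspan (zs : seq A^o)).
- by exists 0%N.
- by move=> _ _ [n ->] [k ->]; exists (n + k)%N; rewrite exprD.
- by move=> _ [n ->]; apply/negP => h; apply: no; exists n.
have [N [Nc Ntop Np]] := regular_prime_chain zsr Pp zsP.
have /dmax : exists N : nat -> ideal A, strict_chain N d.+1 /\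
    forall i, (i <= d.+1)%N -> prime_ideal (N i); last by rewrite ltnn.
exists (fun i => if (i <= d)%N then N i else m); rewrite -szs; split=> i; last first.
  have [ile _|_ _] := leqP i (size zs); first exact: Np.
  split; first exact: (max1 A_local).
  move=> u v uvm; apply/orP; case: (boolP (u \in m)) => um; first by left.
  by right; exact: (max_prime A_noeth A_local uvm).
rewrite ltnS => ize /=; rewrite ize.
have [ilt|ige] := ltnP i (size zs); first exact: Nc.
have -> : i = size zs by apply/eqP; rewrite eqn_leq ize.
rewrite Ntop; split; first by apply: (proper_sub A_noeth A_local); case: Pp.
by exists y => //; apply: yP; exists 1%N; rewrite expr1.
Qed.
End Dimension.

Lemma sum_mons (R : comNzRingType) (xs : seq R) N :
  (\sum_(e < N.+1) size (mons xs e) = 'C(N + size xs, size xs))%N.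
Proof.
rewrite -(size_mons_cons 0).
elim: N => [|N IH]; first by rewrite big_ord1 mons0 mons0.
by rewrite big_ord_recr IH mons_cons size_cat size_map addnC.
Qed.

(** The ratio of the binomials for [s = d + 1] is [(N + d + 1) / (d + 1)]. *)
Lemma binomial_growth b d s : (d < s)%N ->
  exists N, (b * 'C(N + d, d) < 'C(N + s, s))%N.
Proof.
move=> ds; exists (b * d.+1)%N; set N := (b * d.+1)%N.
apply: (@leq_trans 'C(N + d.+1, d.+1)); last first.
  rewrite -!(bin_sub (leq_addl _ _)) !addnK; apply: leq_bin2l.
  by rewrite leq_add2l.
rewrite -(ltn_pmul2l (ltn0Sn d)).
have := mul_bin_diag (N + d.+1) d; rewrite addnS /= => <-.
rewrite mulnA ltn_pmul2r; last by rewrite bin_gt0 leq_addl.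
by rewrite mulnC -/N ltnS leq_addr.
Qed.

(** * Regular generators of a minimal reduction *)

Section ReductionGenerators.
Variables (A : comNzRingType) (m : ideal A) (d : nat).
Hypotheses (A_noeth : noetherian A) (A_local : local_ring m).
Hypotheses (A_residue : infinite_residue_field m) (A_dim : krull_dim A d).
Variables (ys : seq A).
Hypotheses (ys_size : size ys = d) (ys_m : {subset ys <= m})
  (ys_reg : regseq (zeroS : ideal A) ys).

Lemma parametric_primary (I : ideal A) xs : lspan (xs : seq A^o) = I ->
  (forall y, y \in m -> exists n, y ^+ n \in I) ->
  forall (U : lmodType A) (S : submodClosed U), parametric m S xs.
Proof.
move=> xsI mI U S y /mI[n yn]; exists n, (y ^+ n); rewrite xsI; split=> // u.
by rewrite subrr scale0r rpred0.
Qed.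

Lemma lspan_pad (xs : seq A) n : lspan ((xs ++ nseq n 0) : seq A^o) = lspan (xs : seq A^o).
Proof.
rewrite lspan_cat; apply: sub_antiS; last exact: addSl.
apply: addS_sub => //; apply: lspan_sub => x /nseqP[-> _]; exact: rpred0.
Qed.

(** A regular sequence [zs] of length [d] in [I] bounds the length of
    [A / I ^ (N + 1)] by a multiple of [binomial (N + d) d], whereas [s]
    generators of a minimal reduction without relations over the residue field
    make it at least [binomial (N + s) s]. *)
Lemma minimal_reduction_generators (I J : ideal A) k :
  {subset I <= m} -> (forall y, y \in m -> exists n, y ^+ n \in I) ->
  minimal_reduction J I -> reduction_from J I k ->
  exists2 xs : seq A, size xs = d & lspan (xs : seq A^o) = J.
Proof.
move=> Im mI Jmin Jred.
have [c cP] := residues A_residue.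
have [xsI xsIE] := noethA A_noeth I.
(* Zeros make the list of generators as long as [exchange] requires. *)
have padE := etrans (lspan_pad xsI d) (esym xsIE).
have [zs [xs' [szs _ zsI zsr _]]] : exists zs xs' : seq A, [/\ size zs = d,
    size (zs ++ xs') = size (xsI ++ nseq d 0 : seq A),
    lspan ((zs ++ xs') : seq A^o) = lspan ((xsI ++ nseq d 0) : seq A^o),
    regseq (zeroS : ideal A) zs & regseq (zeroS : ideal A) zs].
  apply: (exchange A_noeth A_local cP (noethA A_noeth) (noethA A_noeth) ys_size ys_size) => //.
  - by rewrite size_cat size_nseq leq_addl.
  - exact: parametric_primary padE mI _ _.
  - exact: parametric_primary padE mI _ _.
have QI : {subset lspan (zs : seq A^o) <= I}.
  rewrite -padE -zsI; apply: lspan_mono => x xzs; by rewrite mem_cat xzs.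
have [b bP] := chain_le_primary A_noeth A_local
  (regular_parameters A_noeth A_local A_dim szs zsr (fun x h => Im x (QI x h))).
(* As few generators as possible, for [fewer_generators] to contradict. *)
have ex : exists n, `[< exists2 xs : seq A, size xs = n & lspan (xs : seq A^o) = J >].
  by have [xs xsJ] := noethA A_noeth J; exists (size xs); apply/asboolP; exists xs.
have [s /asboolP[xs sxs xsJ] smin] := ex_minnP ex.
have [sd|ds] := leqP s d.
  exists (xs ++ nseq (d - s) 0); last by rewrite lspan_pad.
  by rewrite size_cat size_nseq sxs subnKC.
exfalso; have [N] := binomial_growth b ds; rewrite ltnNge => /negP; apply.
rewrite -sxs -szs -!sum_mons; apply: (chain_le_power (N := N.+1) bP).
apply: (chain_monol (S := idealX I N.+1)); first exact: idealX_mono.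
apply: (power_chain A_local) => //.
  move=> e x xe; apply: (idealX_mono (I := J)); first by case: Jmin => [[]].
  by rewrite -xsJ -lspan_mons; exact: mem_lspan.
move=> e cs scs dcs; apply: contrapT => csm.
have [ys' sys ysJ] := fewer_generators A_noeth A_local cP Jmin Jred xsJ scs csm dcs.
have : (s <= size ys')%N by apply: smin; apply/asboolP; exists ys'.
by rewrite leqNgt -sxs sys.
Qed.

(** As [J] has exactly [d] generators, [exchange] replaces all of them. *)
Lemma reduction_regular (M : lmodType A) (ys' : seq A) (I J : ideal A) k :
  noethM M -> size ys' = d -> {subset ys' <= m} -> regseq (zeroS : submodClosed M) ys' ->
  {subset I <= m} -> (forall y, y \in m -> exists n, y ^+ n \in I) ->
  (forall y, y \in m -> exists n, y ^+ n \in J) ->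
  minimal_reduction J I -> reduction_from J I k ->
  exists zs : seq A, [/\ size zs = d, lspan (zs : seq A^o) = J,
    regseq (zeroS : ideal A) zs & regseq (zeroS : submodClosed M) zs].
Proof.
move=> Mn sys' ysm' ysr' Im mI mJ Jmin Jred.
have [xs sxs xsJ] := minimal_reduction_generators Im mI Jmin Jred.
have [c cP] := residues A_residue.
have [|||||||zs [xs' [szs s1 s2 zsr zsr']]] := exchange A_noeth A_local cP
  (noethA A_noeth) Mn (S := zeroS) (T := zeroS) (xs := xs) ys_size sys'.
all: rewrite ?sxs //; try exact: parametric_primary xsJ mJ _ _.
exists zs; split=> //; rewrite -xsJ -s2.
suff -> : xs' = [::] by rewrite cats0.
by apply/eqP; rewrite -size_eq0 -(eqn_add2l (size zs)) -size_cat s1 sxs szs addn0.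
Qed.
End ReductionGenerators.

Lemma regular_seq_regseq (A : comNzRingType) (M : lmodType A) (xs : seq A) :
  regular_seq M xs -> regseq (zeroS : submodClosed M) xs.
Proof.
move=> [xr _]; rewrite -[xs]take_size; move: (leqnn (size xs)).
elim: {1 3}(size xs) => [|k IH] kxs; first by rewrite take0.
rewrite (take_nth 0) //; apply/regseq_rcons; split; first exact/IH/ltnW.
move=> u; rewrite addxs_lspan => xu.
by apply/qpi0/(xr k kxs); rewrite -linearZ; apply/qpi0.
Qed.

(** * Regular sequences are quasi-regular *)

Section QuasiRegular.
Variable A : comNzRingType.
Implicit Types (J K : ideal A) (xs ms cs : seq A).

Lemma lspan_rev xs : lspan (rev xs : seq A^o) = lspan (xs : seq A^o).
Proof. by apply: sub_antiS; apply: lspan_mono => x; rewrite mem_rev. Qed.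

(** Forms lose their head variable first, whereas a regular sequence can only lose
    its last term: the variables are listed in reverse. *)
Lemma regseq_rev_cons (U : lmodType A) x xs :
  regseq (zeroS : submodClosed U) (rev (x :: xs)) <->
  regseq (zeroS : submodClosed U) (rev xs) /\
  reg x (mulS (lspan (xs : seq A^o)) (fullS : submodClosed U)).
Proof. by rewrite rev_cons regseq_rcons addxs_lspan lspan_rev. Qed.

Lemma dot_mulS K ms cs : {subset cs <= K} -> dot cs ms \in mulS K (lspan (ms : seq A^o)).
Proof.
elim: cs ms => [|c cs IH] [|y ms] csK; rewrite ?ideal0 //.
rewrite [dot _ _]/=; apply: idealD.
  by apply: (mulS_mem (U := A^o)); [exact/csK/mem_head | exact/mem_lspan/mem_head].
have /IH h : {subset cs <= K} by move=> z zcs; apply: csK; rewrite inE zcs orbT.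
by apply: mulS_mono (h ms) => //; apply: lspan_mono => z zms; rewrite inE zms orbT.
Qed.

Lemma mulS_dot K ms (v : A) : v \in mulS K (lspan (ms : seq A^o)) ->
  exists2 cs, size cs = size ms & {subset cs <= K} /\ v = dot cs ms.
Proof.
elim: ms v => [|y ms IH] v.
  have -> : mulS K (lspan ([::] : seq A^o)) = zeroS.
    apply: sub_antiS; last by move=> z /zeroSP ->; exact: rpred0.
    by apply: mulS_sub => a u _ /lspan_nil ->; rewrite scaler0 rpred0.
  by move/zeroSP ->; exists [::].
have sub : {subset mulS K (lspan (y :: ms : seq A^o)) <=
    addS (mulS K (lspan (ms : seq A^o))) (imS (GRing.scale y : {linear A^o -> A^o}) K)}.
  apply: mulS_sub => a u aK; rewrite lspan_cons => /addcP[b ub].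
  apply/addSP; exists (y * (a * b)); first by apply/imSP; exists (a * b) => //; exact: idealMr.
  have -> : a *: u - y * (a * b) = a *: (u - b *: (y : A^o)).
    by rewrite /GRing.scale /=; ring.
  exact: (mulS_mem (U := A^o)).
move=> /sub/addSP[_ /imSP[a aK <-] /IH[cs scs [csK E]]].
exists (a :: cs); first by rewrite /= scs.
split; last by rewrite /= -E [a * y]mulrC addrC subrK.
by move=> z; rewrite inE => /orP[/eqP ->|/csK].
Qed.

Lemma dot_comb ms cs ds (x : A) : size cs = size ms -> size ds = size ms ->
  dot [seq p.1 + x * p.2 | p <- zip cs ds] ms = dot cs ms + x * dot ds ms.
Proof.
elim: ms cs ds => [|y ms IH] [|c cs] [|d ds] //=; first by rewrite mulr0 addr0.
by case=> s1 [s2]; rewrite IH //; ring.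
Qed.

Lemma comb_mem K n cs ds (x : A) : size cs = n -> size ds = n ->
  {subset [seq p.1 + x * p.2 | p <- zip cs ds] <= K} ->
  forall i, cs`_i + x * ds`_i \in K.
Proof.
move=> scs sds h i; have [ilt|ige] := ltnP i n; last first.
  by rewrite !nth_default ?scs ?sds // mulr0 addr0 ideal0.
apply: h; apply/(nthP 0); exists i; first by rewrite size_map size_zip scs sds minnn.
by rewrite (nth_map (0, 0)) ?size_zip ?scs ?sds ?minnn // nth_zip // scs sds.
Qed.

(** A combination lying in [K <ms>] differs by a relation from one with
    coefficients in [K]. *)
Lemma relation_coefs K ms :
  (forall ds, size ds = size ms -> dot ds ms = 0 -> {subset ds <= K}) ->
  forall cs, size cs = size ms -> dot cs ms \in mulS K (lspan (ms : seq A^o)) ->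
  {subset cs <= K}.
Proof.
move=> rel cs scs /mulS_dot[ds sds [dsK E]] c /(nthP 0)[i isz <-].
have /(comb_mem scs sds)/(_ i) : {subset [seq p.1 + -1 * p.2 | p <- zip cs ds] <= K}.
  apply: rel; first by rewrite size_map size_zip scs sds minnn.
  by rewrite dot_comb // E mulN1r subrr.
rewrite mulN1r => h; rewrite -(subrK ds`_i cs`_i); apply: idealD => //.
by apply/dsK/mem_nth; rewrite sds -scs.
Qed.

(** For [G + x H = 0], regularity of [x] modulo the powers of the ideal [<xs>]
    moves [H] into [<xs> ^ (n + 1)], and the relation becomes one between
    the monomials in [xs]. *)
Lemma form_relations xs : regseq (zeroS : ideal A) (rev xs) -> forall n cs,
  size cs = size (mons xs n) -> dot cs (mons xs n) = 0 -> {subset cs <= lspan (xs : seq A^o)}.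
Proof.
elim: xs => [|x xs IH].
  move=> _ [|n] [|c [|? ?]] //= _.
  by rewrite mulr1 addr0 => ->; move=> z; rewrite inE => /eqP ->; exact: ideal0.
move=> /regseq_rev_cons[/IH{}IH]; rewrite mulSC mul1S => xreg.
set J' := lspan (xs : seq A^o) in IH xreg *; set J := lspan _.
have J'J : {subset J' <= J} by apply: lspan_mono => z zxs; rewrite inE zxs orbT.
have xJ : x \in J by exact/mem_lspan/mem_head.
have xregX k : forall u : A, x * u \in idealX J' k -> u \in idealX J' k.
  elim: k => [//|k IHk] u xu.
  have : u \in idealX J' k by apply: IHk; apply: mulS_subr xu.
  rewrite -{1}lspan_mons => /lspan_dot[cs scs E].
  suff csJ : {subset cs <= J'}.
    by rewrite E -[idealX _ _]/(mulS J' (idealX J' k)) -lspan_mons; exact: dot_mulS.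
  have h : {subset [seq x * c | c <- cs] <= J'}.
    apply: (relation_coefs (ms := mons xs k)); first exact: IH.
      by rewrite size_map.
    by rewrite dot_scalel -E lspan_mons; exact: xu.
  by move=> c ccs; apply: xreg; exact/h/map_f.
elim=> [|n IHn] cs scs.
  case: cs scs => [|c [|? ?]] //= _; rewrite mulr1 addr0 => ->.
  by move=> z; rewrite inE => /eqP ->; exact: ideal0.
have [] := dot_split scs; set k := size (mons xs n.+1).
set c1 := take _ cs; set c2 := drop _ cs => s1 s2 -> E.
have GJ : dot c1 (mons xs n.+1) \in idealX J' n.+1.
  by apply: dot_idealX => y; exact: (mem_lspan (U := A^o)).
have HJ' : dot c2 (mons (x :: xs) n) \in idealX J' n.+1.
  apply: xregX; rewrite -[x * _]opprK; apply: (memN (U := A^o)).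
  by move/eqP: E; rewrite addr_eq0 => /eqP <-.
have c2J : {subset c2 <= J}.
  apply: (relation_coefs (ms := mons (x :: xs) n)) => //.
  by rewrite lspan_mons; exact: (idealX_mono (n := n.+1) J'J).
have [ds sds E2] : exists2 ds, size ds = size (mons xs n.+1) &
    dot c2 (mons (x :: xs) n) = dot ds (mons xs n.+1).
  by apply/lspan_dot; rewrite lspan_mons.
have /(comb_mem s1 sds) h : {subset [seq p.1 + x * p.2 | p <- zip c1 ds] <= J'}.
  apply: (IH n.+1); first by rewrite size_map size_zip s1 sds minnn.
  by rewrite dot_comb // -E2.
move=> c; rewrite -(cat_take_drop k cs) mem_cat => /orP[|/c2J //].
move=> /(nthP 0)[i isz <-]; rewrite -(addrK (x * ds`_i) (_`_i)).
by apply: idealB; [exact/J'J/h | exact: idealMr].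
Qed.

(** The case [K = J] is quasi-regularity; the case [K = I] makes
    [J ^ n / I J ^ n] free over [A / I]. *)
Lemma quasi_regular xs K n (c : nat -> A) : regseq (zeroS : ideal A) (rev xs) ->
  {subset lspan (xs : seq A^o) <= K} ->
  \sum_(i < size (mons xs n)) c i * (mons xs n)`_i \in mulS K (idealX (lspan (xs : seq A^o)) n) ->
  forall i, (i < size (mons xs n))%N -> c i \in K.
Proof.
move=> xr JK; rewrite -dot_sum -lspan_mons => h i isz.
apply: (relation_coefs _ _ h); last 1 first.
- by apply/mapP; exists i; rewrite // mem_iota.
- by move=> ds sds E z zds; exact/JK/(form_relations xr sds E).
- by rewrite size_mkseq.
Qed.
End QuasiRegular.

(** * Homology of a free resolution modulo an ideal *)

Section Rows.
Variables (A : comNzRingType).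
Implicit Types (K : ideal A).

Fact rowS_lin K n : lin_closed (fun v : 'rV[A]_n => forall k, v 0 k \in K).
Proof.
split=> [k|a u v uK vK k]; rewrite !mxE; first exact: ideal0.
by apply: idealD => //; exact: idealM.
Qed.
Definition rowS K n := mkS (rowS_lin K n).
Lemma rowSP K n v : v \in rowS K n <-> forall k, v 0 k \in K.
Proof. exact: mkSP. Qed.

Lemma rowS_mono K K' n : {subset K <= K'} -> {subset rowS K n <= rowS K' n}.
Proof. by move=> KK' v /rowSP vK; apply/rowSP => k; exact/KK'/vK. Qed.

Lemma rowS_mul K n p (v : 'rV_n) (D : 'M_(n, p)) : v \in rowS K n -> v *m D \in rowS K p.
Proof.
move=> /rowSP vK; apply/rowSP => k; rewrite mxE.
by apply: (big_ind (fun x : A => x \in K)) => [|x y|i _];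
  [exact: ideal0 | exact: idealD | exact: idealMr].
Qed.

Lemma rowS_scale K K' n (a : A) (v : 'rV_n) :
  (forall b : A, b \in K -> a * b \in K') -> v \in rowS K n -> a *: v \in rowS K' n.
Proof. by move=> h /rowSP vK; apply/rowSP => k; rewrite mxE; exact: h. Qed.

Lemma rowS_addc K (x : A) n (v : 'rV_n) :
  v \in rowS (addc K x) n -> exists b, v - x *: b \in rowS K n.
Proof.
move=> /rowSP vK; have /choice[b bP] : forall k, exists b : A, v 0 k - b * x \in K.
  by move=> k; have /addcP := vK k.
exists (\row_k b k); apply/rowSP => k; rewrite !mxE mulrC; exact: bP.
Qed.

Lemma rowS_lspan ms n (v : 'rV_n) : v \in rowS (lspan (ms : seq A^o)) n ->
  exists c : nat -> 'rV_n, v = \sum_(i < size ms) ms`_i *: c i.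
Proof.
move=> /rowSP vK; have /choice[b bP] : forall k, exists b, size b = size ms /\ v 0 k = dot b ms.
  by move=> k; have /lspan_dot[b sb E] := vK k; exists b.
exists (fun i => \row_k (b k)`_i); apply/rowP => k; have [sb ->] := bP k.
rewrite summxE -[in LHS](mkseq_nth 0 (b k)) sb dot_sum.
by apply: eq_bigr => i _; rewrite !mxE mulrC.
Qed.
End Rows.

Section Resolution.
Variables (A : comNzRingType) (M : lmodType A) (F : free_resolution M).
Implicit Types (I J K : ideal A).

Local Notation r := (res_rank F).
Local Notation D := (res_diff F).

Lemma diff_comp j (w : 'rV_(r j.+2)) : w *m D j.+1 *m D j = 0.
Proof. by apply/res_exactS; exists w. Qed.

(** Vanishing of [Tor_i (M, A / K)] for all [i >= 1] *)
Definition exact_mod K := forall j (v : 'rV_(r j.+1)),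
  v *m D j \in rowS K _ -> exists w, v - w *m D j.+1 \in rowS K _.

Lemma aug_lift K (b : 'rV_(r 0)) : res_aug F b \in mulS K fullS ->
  exists c, b - c *m D 0 \in rowS K _.
Proof.
have sub : {subset mulS K (fullS : submodClosed M) <= imS (res_aug F) (rowS K (r 0))}.
  apply: mulS_sub => a u aK _; have [x <-] := res_aug_surj F u.
  apply/imSP; exists (a *: x); last by rewrite linearZ.
  by apply/rowSP => k; rewrite mxE; exact: idealMr.
move=> /sub/imSP[y yK yE].
have /res_exact0[c cE] : res_aug F (b - y) = 0 by rewrite linearB yE subrr.
by exists c; rewrite -cE subKr.
Qed.

Lemma aug_rowS K (b : 'rV_(r 0)) : b \in rowS K _ -> res_aug F b \in mulS K fullS.
Proof.
move=> /rowSP bK; rewrite [b]row_sum_delta linear_sum; apply: rpred_sum => k _.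
by rewrite linearZ; apply: mulS_mem.
Qed.

(** The long exact sequence of [0 -> A / K -> A / K -> A / (K + x A) -> 0]. *)
Lemma exact_mod_addc K (x : A) : exact_mod K -> reg x K ->
  reg x (mulS K (fullS : submodClosed M)) -> exact_mod (addc K x).
Proof.
move=> exK xK xKM j v /rowS_addc[b vb].
have [c bc] : exists c, b - c *m D j \in rowS K _.
  case: j v b vb => [|j] v b vb.
    apply/aug_lift/xKM; have := aug_rowS vb; rewrite linearB linearZ.
    have -> : res_aug F (v *m D 0) = 0 by apply/res_exact0; exists v.
    by rewrite sub0r => /memN; rewrite opprK.
  apply: exK; apply/rowSP => k; apply: xK.
  have := rowS_mul (D j) vb; rewrite mulmxBl diff_comp sub0r => /memN/rowSP/(_ k).
  by rewrite opprK -scalemxAl mxE.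
have [|w vw] := exK j (v - x *: c).
  have -> : (v - x *: c) *m D j = (v *m D j - x *: b) + x *: (b - c *m D j).
    by rewrite mulmxBl -scalemxAl scalerBr addrA subrK.
  by rewrite rpredD // rpredZ.
exists w; have -> : v - w *m D j.+1 = (v - x *: c - w *m D j.+1) + x *: c.
  by rewrite addrAC subrK.
apply: rpredD; first by apply: rowS_mono vw; exact: addcl.
by apply/rowSP => k; rewrite mxE; apply/idealMr/addcr.
Qed.

Lemma exact_mod_regseq xs : regseq (zeroS : ideal A) (rev xs) ->
  regseq (zeroS : submodClosed M) (rev xs) -> exact_mod (lspan (xs : seq A^o)).
Proof.
elim: xs => [|x xs IH].
  have -> : lspan ([::] : seq A^o) = zeroS.
    apply: sub_antiS => z; first by move=> /lspan_nil/zeroSP.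
    by move=> /zeroSP ->; exact: rpred0.
  move=> _ _ j v /rowSP v0.
  have /res_exactS[w ->] : v *m D j = 0.
    by apply/rowP => k; rewrite mxE [RHS]mxE; have /zeroSP := v0 k; rewrite mxE.
  by exists w; rewrite subrr rpred0.
move=> /regseq_rev_cons[xr xA] /regseq_rev_cons[xr' xM].
rewrite lspan_cons; apply: exact_mod_addc xM; first exact: IH.
by move: xA; rewrite mulSC mul1S.
Qed.

(** The cycles and boundaries of the resolution reduced modulo [K], lifted to the
    free module: the quotient of [cycles K j] by [boundaries K j] is
    [Tor_(j+1) (M, A / K)]. *)
Fact cycles_lin K j : lin_closed (fun v : 'rV_(r j.+1) => v *m D j \in rowS K _).
Proof.
split=> [|a u v uK vK]; first by rewrite mul0mx rpred0.
by rewrite mulmxDl -scalemxAl; apply: rpredD => //; exact: rpredZ.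
Qed.
Definition cycles K j := mkS (cycles_lin K j).
Lemma cyclesP K j v : v \in cycles K j <-> v *m D j \in rowS K _.
Proof. exact: mkSP. Qed.

Fact boundaries_lin K j : lin_closed (fun v : 'rV_(r j.+1) =>
  exists w, v - w *m D j.+1 \in rowS K _).
Proof.
split=> [|a u v [w uw] [w' vw']]; first by exists 0; rewrite mul0mx subrr rpred0.
exists (a *: w + w').
have -> : a *: u + v - (a *: w + w') *m D j.+1 = a *: (u - w *m D j.+1) + (v - w' *m D j.+1).
  by rewrite mulmxDl -scalemxAl opprD addrACA scalerBr.
by apply: rpredD => //; exact: rpredZ.
Qed.
Definition boundaries K j := mkS (boundaries_lin K j).
Lemma boundariesP K j v : v \in boundaries K j <-> exists w, v - w *m D j.+1 \in rowS K _.
Proof. exact: mkSP. Qed.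

Lemma boundaries_cycles K j : {subset boundaries K j <= cycles K j}.
Proof.
move=> v /boundariesP[w vw]; apply/cyclesP.
by have := rowS_mul (D j) vw; rewrite mulmxBl diff_comp subr0.
Qed.

Section Powers.
Variables (xs : seq A).
Hypotheses (xs_A : regseq (zeroS : ideal A) (rev xs))
  (xs_M : regseq (zeroS : submodClosed M) (rev xs)).
Local Notation J := (lspan (xs : seq A^o)).

Lemma rowS_coefs K n p (c : nat -> 'rV_p) : {subset J <= K} ->
  \sum_(i < size (mons xs n)) (mons xs n)`_i *: c i \in rowS (mulS K (idealX J n)) p ->
  forall i, (i < size (mons xs n))%N -> c i \in rowS K p.
Proof.
move=> JK /rowSP h i isz; apply/rowSP => k.
apply: (quasi_regular (xs := xs) (n := n) (c := fun i => c i 0 k)) => //.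
rewrite (eq_bigr (fun i : 'I__ => ((mons xs n)`_i *: c i) 0 k)).
  by have := h k; rewrite summxE.
by move=> i' _; rewrite !mxE mulrC.
Qed.

Lemma mons_scale_rowS K n p i (v : 'rV_p) : (i < size (mons xs n))%N ->
  v \in rowS K p -> (mons xs n)`_i *: v \in rowS (mulS K (idealX J n)) p.
Proof.
move=> isz; apply: rowS_scale => b bK; rewrite mulrC.
apply: (mulS_mem (U := A^o)) => //; rewrite -lspan_mons.
exact/mem_lspan/mem_nth.
Qed.

(** A cycle modulo [J ^ (n+1)] is, up to a boundary, a combination of the
    monomials of degree [n]; by quasi-regularity its coefficients are cycles
    modulo [J], hence boundaries modulo [J]. *)
Lemma exact_mod_power n : exact_mod (idealX J n).
Proof.
elim: n => [|n IH] j v vD; first by exists 0; apply/rowSP.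
have [|w vw] := IH j v; first by apply: rowS_mono vD; exact: mulS_subr.
have [c cE] : exists c : nat -> 'rV_(r j.+1),
    v - w *m D j.+1 = \sum_(i < size (mons xs n)) (mons xs n)`_i *: c i.
  by apply: rowS_lspan; rewrite lspan_mons.
have cD i : (i < size (mons xs n))%N -> c i *m D j \in rowS J _.
  move: i; apply: (rowS_coefs (n := n) (c := fun i => c i *m D j)) => //.
  suff -> : \sum_(i0 < size (mons xs n)) (mons xs n)`_i0 *: (c i0 *m D j) = v *m D j by [].
  have -> : v *m D j = (v - w *m D j.+1) *m D j by rewrite mulmxBl diff_comp subr0.
  rewrite cE mulmx_suml.
  by apply: eq_bigr => i0 _; rewrite scalemxAl.
have /choice[w' w'P] : forall i, exists w,
    (i < size (mons xs n))%N -> c i - w *m D j.+1 \in rowS J _.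
  move=> i; have [isz|] := boolP (i < size (mons xs n))%N; last by exists 0.
  by have [w' w'P] := exact_mod_regseq xs_A xs_M (cD i isz); exists w'.
exists (w + \sum_(i < size (mons xs n)) (mons xs n)`_i *: w' i).
rewrite mulmxDl opprD addrA cE mulmx_suml -sumrB; apply: rpred_sum => i _.
by rewrite -scalemxAl -scalerBr; apply: mons_scale_rowS => //; exact: w'P.
Qed.

Variables (I : ideal A) (JI : {subset J <= I}) (n j : nat).
Local Notation ms := (mons xs n).
Local Notation In := (mulS I (idealX J n)).

(** A filtration from the boundaries to the cycles modulo [I J ^ n], with one
    step for each monomial; multiplication by that monomial identifies the step
    with the homology modulo [I]. *)
Fact cycle_filt_lin k : lin_closed (fun v => exists z : nat -> 'rV_(r j.+1),
  (forall i, z i \in cycles I j) /\ v - \sum_(i < k) ms`_i *: z i \in boundaries In j).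
Proof.
split=> [|a u v [z [zc uz]] [z' [zc' vz']]].
  exists (fun=> 0); split=> [i|]; first exact: rpred0.
  by rewrite big1 ?subr0 ?rpred0 // => i _; rewrite scaler0.
exists (fun i => a *: z i + z' i); split=> [i|].
  by apply: rpredD => //; exact: rpredZ.
have -> : a *: u + v - \sum_(i < k) ms`_i *: (a *: z i + z' i) =
    a *: (u - \sum_(i < k) ms`_i *: z i) + (v - \sum_(i < k) ms`_i *: z' i).
  rewrite scalerBr addrACA -opprD scaler_sumr -big_split /=; congr (_ - _).
  by apply: eq_bigr => i _; rewrite scalerDr !scalerA mulrC.
by apply: rpredD => //; exact: rpredZ.
Qed.
Definition cycle_filt k := mkS (cycle_filt_lin k).
Lemma cycle_filtP k v : v \in cycle_filt k <-> exists z : nat -> 'rV_(r j.+1),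
  (forall i, z i \in cycles I j) /\ v - \sum_(i < k) ms`_i *: z i \in boundaries In j.
Proof. exact: mkSP. Qed.

Lemma cycle_filt0 : cycle_filt 0 = boundaries In j.
Proof.
apply: sub_antiS => v; first by move=> /cycle_filtP[z [_]]; rewrite big_ord0 subr0.
move=> vb; apply/cycle_filtP; exists (fun=> 0); rewrite big_ord0 subr0.
by split=> // i; exact: rpred0.
Qed.

Lemma mons_cycles i v : (i < size ms)%N -> v \in cycles I j -> ms`_i *: v \in cycles In j.
Proof.
by move=> isz /cyclesP vI; apply/cyclesP; rewrite -scalemxAl; exact: mons_scale_rowS.
Qed.

Lemma mons_boundaries i v : (i < size ms)%N ->
  v \in boundaries I j -> ms`_i *: v \in boundaries In j.
Proof.
move=> isz /boundariesP[w vw]; apply/boundariesP; exists (ms`_i *: w).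
by rewrite -scalemxAl -scalerBr; exact: mons_scale_rowS.
Qed.

(** A cycle modulo [I J ^ n] is a cycle modulo [J ^ n], hence a boundary up to a
    combination of monomials, whose coefficients are cycles modulo [I] by
    quasi-regularity. *)
Lemma cycle_filt_all : cycle_filt (size ms) = cycles In j.
Proof.
apply: sub_antiS => v.
  move=> /cycle_filtP[z [zc /boundaries_cycles vz]].
  rewrite -(subrK (\sum_(i < size ms) ms`_i *: z i) v) rpredD //.
  by apply: rpred_sum => i _; exact: mons_cycles.
move=> /cyclesP vD.
have [|w vw] := @exact_mod_power n j v.
  by apply: rowS_mono vD; exact: mulS_subr.
have [z zE] : exists z : nat -> 'rV_(r j.+1), v - w *m D j.+1 = \sum_(i < size ms) ms`_i *: z i.
  by apply: rowS_lspan; rewrite lspan_mons.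
have zI i : (i < size ms)%N -> z i \in cycles I j.
  move=> isz; apply/cyclesP; move: i isz.
  apply: (rowS_coefs (n := n) (c := fun i => z i *m D j)) => //.
  suff -> : \sum_(i0 < size ms) ms`_i0 *: (z i0 *m D j) = v *m D j by [].
  have -> : v *m D j = (v - w *m D j.+1) *m D j by rewrite mulmxBl diff_comp subr0.
  rewrite zE mulmx_suml.
  by apply: eq_bigr => i0 _; rewrite scalemxAl.
apply/cycle_filtP; exists (fun i => if (i < size ms)%N then z i else 0); split.
  by move=> i; case: ifP => [/zI //|_]; exact: rpred0.
apply/boundariesP; exists w.
rewrite (eq_bigr (fun i : 'I_(size ms) => ms`_i *: z i)) => [|i _]; last by rewrite ltn_ord.
by rewrite -zE subKr subrr rpred0.
Qed.

(** Quasi-regularity compares coefficients once the boundary is written as the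
    image of a combination of the monomials, which is possible because the
    homology modulo [J ^ n] vanishes one degree higher. *)
Lemma boundaries_coefs (z : nat -> 'rV_(r j.+1)) :
  \sum_(i < size ms) ms`_i *: z i \in boundaries In j ->
  forall i, (i < size ms)%N -> z i \in boundaries I j.
Proof.
move=> /boundariesP[w zw].
have [|w2 ww2] := @exact_mod_power n j.+1 w.
  rewrite -(subKr (\sum_(i < size ms) ms`_i *: z i) (w *m _)); apply: memB.
    apply: rpred_sum => i _; apply/rowSP => k; rewrite mxE; apply: idealMr.
    by rewrite -lspan_mons; exact/mem_lspan/mem_nth.
  by apply: rowS_mono zw; exact: mulS_subr.
have [w' w'E] : exists w' : nat -> 'rV_(r j.+2),
    w - w2 *m D j.+2 = \sum_(i < size ms) ms`_i *: w' i.
  by apply: rowS_lspan; rewrite lspan_mons.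
move=> i isz; apply/boundariesP; exists (w' i); move: i isz.
apply: (rowS_coefs (n := n) (c := fun i => z i - w' i *m D j.+1)) => //.
have -> : \sum_(i < size ms) ms`_i *: (z i - w' i *m D j.+1) =
    \sum_(i < size ms) ms`_i *: z i - w *m D j.+1; last exact: zw.
have -> : w *m D j.+1 = (w - w2 *m D j.+2) *m D j.+1 by rewrite mulmxBl diff_comp subr0.
rewrite w'E mulmx_suml -sumrB.
by apply: eq_bigr => i _; rewrite scalerBr scalemxAl.
Qed.

Lemma cycle_filt_mono k : {subset cycle_filt k <= cycle_filt k.+1}.
Proof.
move=> v /cycle_filtP[z [zc vz]]; apply/cycle_filtP.
exists (fun i => if (i < k)%N then z i else 0); split.
  by move=> i; case: ifP => // _; exact: rpred0.
rewrite big_ord_recr /= ltnn scaler0 addr0.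
by rewrite (eq_bigr (fun i : 'I_k => ms`_i *: z i)) // => i _; rewrite ltn_ord.
Qed.

Lemma cycle_filt_chain k l : (k < size ms)%N ->
  has_chain (boundaries I j) (cycles I j) l <-> has_chain (cycle_filt k) (cycle_filt k.+1) l.
Proof.
move=> kms.
pose f : {linear 'rV[A]_(r j.+1) -> 'rV[A]_(r j.+1)} := GRing.scale ms`_k.
have fE v : f v = ms`_k *: v by [].
have filt0 i v : v \in boundaries In j -> v \in cycle_filt i.
  by elim: i => [|i IH]; [rewrite cycle_filt0 | move=> /IH/cycle_filt_mono].
have fT v : v \in cycles I j -> f v \in cycle_filt k.+1.
  move=> vc; rewrite fE; apply/cycle_filtP; exists (fun i => if i == k then v else 0); split.
    by move=> i; case: ifP => // _; exact: rpred0.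
  rewrite big_ord_recr /= eqxx big1 ?add0r ?subrr ?rpred0 // => i _.
  by rewrite (ltn_eqF (ltn_ord i)) scaler0.
apply: (chain_map (f := f)) => //.
- by move=> v vb; apply/filt0/mons_boundaries.
- exact: boundaries_cycles.
- exact: cycle_filt_mono.
- move=> v vc /cycle_filtP[z [zc vz]].
  pose y i := if (i < k)%N then - z i else if i == k then v else 0.
  have -> : v = y k by rewrite /y ltnn eqxx.
  apply: (boundaries_coefs (z := y)) => //.
  suff <- : f v - \sum_(i < k) ms`_i *: z i = \sum_(i < size ms) ms`_i *: y i by [].
  rewrite -(big_mkord xpredT (fun i => ms`_i *: y i)) (big_cat_nat _ (n := k)) ?(ltnW kms) //=.
  rewrite big_mkord [LHS]addrC; congr (_ + _).
    by rewrite -sumrN; apply: eq_bigr => i _; rewrite /y ltn_ord scalerN.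
  rewrite big_ltn // big_nat big1 => [|i /andP[ki _]].
    by rewrite addr0 /y ltnn eqxx.
  by rewrite /y ltnNge (ltnW ki) (gtn_eqF ki) scaler0.
- move=> v /cycle_filtP[z [zc vz]]; exists (z k) => //.
  apply/cycle_filtP; exists z; split=> //.
  by move: vz; rewrite big_ord_recr /= opprD addrA addrAC.
Qed.

Lemma cycle_filt_len k l : is_len (boundaries I j) (cycles I j) l -> (k <= size ms)%N ->
  is_len (boundaries In j) (cycle_filt k) (k * l).
Proof.
move=> [cl le_l]; elim: k => [|k IH] kms; first by rewrite cycle_filt0; exact: is_len0.
rewrite mulSn addnC; apply: is_len_add (IH (ltnW kms)) _.
split; first exact/(cycle_filt_chain _ kms).
by move=> i /(cycle_filt_chain _ kms)/le_l.
Qed.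

(** Lengths add up along the filtration; in fact [Tor_i (M, A / I J ^ n)] is a
    sum of copies of [Tor_i (M, A / I)], one for each monomial. *)
Lemma tor_len_power l : is_len (boundaries I j) (cycles I j) l ->
  is_len (boundaries In j) (cycles In j) (size ms * l).
Proof. by move=> /cycle_filt_len/(_ (leqnn _)); rewrite cycle_filt_all. Qed.

(** The first monomial embeds the homology modulo [I], which therefore has finite
    length. *)
Lemma tor_len_base b : (0 < size ms)%N -> is_len (boundaries In j) (cycles In j) b ->
  exists l, is_len (boundaries I j) (cycles I j) l.
Proof.
move=> ms0 [_ le_b]; apply: (bounded_len (c := b)); first exact: boundaries_cycles.
move=> k /(cycle_filt_chain _ ms0); rewrite cycle_filt0 => ck; apply: le_b.
apply: chain_monor ck _; rewrite -cycle_filt_all => v.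
elim: (size ms) ms0 => // s IH _; case: s IH => // s IH /IH; move=> h.
exact/cycle_filt_mono/h.
Qed.
End Powers.
End Resolution.

(** * The homology modules of the statement *)

Section TorLength.
Variables (A : comNzRingType).

Lemma length_quot (U : lmodType A) (S : submodClosed U) l :
  has_length (quotmod S) l <-> is_len S fullS l.
Proof.
rewrite has_lengthP; apply: iff_sym; apply: (is_len_map (f := qpi S)) => //.
- by move=> u /qpi0 uS; apply/zeroSP.
- by move=> u _ /zeroSP/qpi0.
- by move=> v _; have [u <-] := qpi_surj v; exists u; rewrite // subrr rpred0.
Qed.

Definition subval (V : lmodType A) (Z : submodClosed V) (z : submod Z) : V := submod_val z.
Fact subval_linear (V : lmodType A) (Z : submodClosed V) : linear (@subval V Z).
Proof. by []. Qed.
HB.instance Definition _ (V : lmodType A) (Z : submodClosed V) :=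
  GRing.isLinear.Build A (submod Z) V *:%R (@subval V Z) (@subval_linear V Z).

Lemma len_submod (V : lmodType A) (Z B : submodClosed V) (S : submodClosed (submod Z)) l :
  {subset B <= Z} -> (forall z, z \in S <-> subval z \in B) ->
  is_len S fullS l <-> is_len B Z l.
Proof.
move=> BZ SB; apply: (is_len_map (f := @subval V Z)) => //.
- by move=> u /SB.
- by case.
- by move=> u _ /SB.
- by move=> v vZ; exists (Submod vZ) => //; rewrite subrr rpred0.
Qed.

Variables (M : lmodType A) (F : free_resolution M) (K : ideal A) (j : nat).
Local Notation r := (res_rank F).
Local Notation D := (res_diff F).
Local Notation N := (quotmod K).

(** The reduction [A^n -> (A / K)^n], which is compatible with the maps
    [tens_map] ([red_row_mul]). *)
Definition red_row n (v : 'rV[A]_n) : {ffun 'I_n -> N} := [ffun k => qpi K (v 0 k)].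
Fact red_row_linear n : linear (@red_row n).
Proof. by move=> a u v; apply/ffunP => k; rewrite !ffunE !mxE -linearP. Qed.
HB.instance Definition _ n :=
  GRing.isLinear.Build A 'rV[A]_n {ffun 'I_n -> N} *:%R (@red_row n) (@red_row_linear n).

Lemma red_row0 n (v : 'rV_n) : red_row v = 0 <-> v \in rowS K n.
Proof.
split=> [/ffunP v0|/rowSP vK]; last by apply/ffunP => k; rewrite !ffunE; exact/qpi0.
by apply/rowSP => k; apply/qpi0; have := v0 k; rewrite !ffunE.
Qed.

Lemma red_row_surj n (f : {ffun 'I_n -> N}) : exists v, red_row v = f.
Proof.
have /choice[v vP] : forall k, exists a : A^o, qpi K a = f k by move=> k; exact: qpi_surj.
by exists (\row_k v k); apply/ffunP => k; rewrite !ffunE mxE.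
Qed.

Lemma red_row_mul n p (v : 'rV_n) (E : 'M_(n, p)) :
  red_row (v *m E) = tens_map E (red_row v).
Proof.
apply/ffunP => k; rewrite !ffunE mxE linear_sum; apply: eq_bigr => i _.
by rewrite ffunE -linearZ /= mulrC.
Qed.

Lemma tor_length l : has_length (Tor F N j.+1) l <-> is_len (boundaries F K j) (cycles F K j) l.
Proof.
pose f : {linear {ffun 'I_(r j.+2) -> N} -> {ffun 'I_(r j.+1) -> N}} := @tens_map A N _ _ (D j.+1).
pose g : {linear {ffun 'I_(r j.+1) -> N} -> {ffun 'I_(r j) -> N}} := @tens_map A N _ _ (D j).
have fE v : f (red_row v) = red_row (v *m D j.+1) by rewrite red_row_mul.
have gE v : g (red_row v) = red_row (v *m D j) by rewrite red_row_mul.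
have kerP z : z \in kerS g <-> g z = 0 by split=> /eqP.
have imP z : z \in imS f fullS <-> exists u, f u = z.
  by split=> [/imSP[u _ <-]|[u <-]]; [exists u | apply/imSP; exists u].
have gf u : g (f u) = 0.
  have [v <-] := red_row_surj u.
  by rewrite fE gE diff_comp; apply/red_row0; exact: rpred0.
have imker : {subset imS f fullS <= kerS g} by move=> z /imP[u <-]; apply/kerP.
rewrite /Tor /homology length_quot.
rewrite (len_submod (B := imS f fullS)) //; last first.
  by move=> z; rewrite imP; split=> [/asboolP|] // ?; apply/asboolP.
apply: iff_sym; apply: (is_len_map (f := @red_row (r j.+1))) => //.
- move=> v /boundariesP[w vw]; apply/imP; exists (red_row w).
  by rewrite fE; apply/eqP; rewrite eq_sym -subr_eq0 -linearB; apply/eqP/red_row0.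
- exact: boundaries_cycles.
- by move=> v /cyclesP vK; apply/kerP; rewrite gE; apply/red_row0.
- move=> v _ /imP[u]; have [w <-] := red_row_surj u; rewrite fE => wv.
  by apply/boundariesP; exists w; apply/red_row0; rewrite linearB /= wv subrr.
- move=> z /kerP; have [v <-] := red_row_surj z; rewrite gE => /red_row0 vK.
  by exists v; [apply/cyclesP | rewrite subrr rpred0].
Qed.
End TorLength.

(** * Conclusion *)

(** A polynomial agreeing for large [n] with [l] times [binomial (n + e) e] is
    that multiple of a product of [e] linear factors. *)
Lemma binomial_poly_degree (t : {poly rat}) l e n0 :
  (forall n, (n0 <= n)%N -> t.[n%:R] = ('C(n + e, e) * l)%:R) ->
  poly_degree t = None \/ poly_degree t = Some e.
Proof.
move=> tE; pose q : {poly rat} := \prod_(z <- [seq - (i.+1%:R) | i <- iota 0 e]) ('X - z%:P).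
have qE n : q.[n%:R] = ('C(n + e, e) * e`!)%:R.
  rewrite bin_ffact horner_prod big_map -{1}[e]subn0 -/(index_iota 0 e) big_mkord.
  elim: e {tE q} => [|e IH]; first by rewrite big_ord0 ffactn0.
  rewrite big_ord_recr IH addnS ffactSS mulnC natrM; congr (_ * _).
  by rewrite !hornerE opprK -natrD addnS.
have e0 : (e`!)%:R != 0 :> rat by rewrite Num.Theory.pnatr_eq0 -lt0n fact_gt0.
have tq : t = (l%:R / (e`!)%:R) *: q.
  apply/eqP; rewrite -subr_eq0; apply: contraT => p0; set p := _ - _ in p0.
  have := max_poly_roots (rs := [seq (n0 + i)%:R | i <- iota 0 (size p)]) p0.
  rewrite size_map size_iota ltnn; apply; last first.
    rewrite map_inj_uniq ?iota_uniq // => i k /eqP.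
    by rewrite Num.Theory.eqr_nat eqn_add2l => /eqP.
  apply/allP => _ /mapP[i _ ->]; rewrite rootE hornerD hornerN hornerZ tE ?leq_addr //.
  by rewrite qE !natrM [_ / _ * _]mulrC mulrACA [_ * _^-1]mulfV // mulr1 subrr.
have [l0|l_gt0] := posnP l.
  by left; rewrite /poly_degree tq l0 mul0r scale0r eqxx.
right; have c0 : l%:R / (e`!)%:R != 0 :> rat.
  by rewrite mulf_neq0 ?invr_eq0 // Num.Theory.pnatr_eq0 -lt0n.
have sq : size t = e.+1.
  by rewrite tq size_scale // size_prod_XsubC size_map size_iota.
by rewrite /poly_degree -size_poly_eq0 sq.
Qed.

Theorem corollary6p3 (A : comNzRingType) (m : ideal A) (d : nat)
    (M : lmodType A) (I : ideal A) (r : nat)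
    (A_noetherian : noetherian A)
    (A_local : local_ring m)
    (A_dim : krull_dim A d)
    (d_ge1 : (1 <= d)%N)
    (A_cm : cohen_macaulay m A^o)
    (A_residue : infinite_residue_field m)
    (M_fg : finitely_generated M)
    (M_mcm : maximal_cohen_macaulay m M)
    (I_primary : primary_to m I)
    (I_red : reduction_number I r)
    (r_le1 : (r <= 1)%N)
    (F : free_resolution M) (i : nat) (i_ge1 : (1 <= i)%N)
    (t : {poly rat}) (t_tor : is_tor_polynomial I F i t) :
  poly_degree t = None \/ poly_degree t = Some (d - 1)%N.
Proof.
have is_max_uniq P a b : is_max P a -> is_max P b -> a = b.
  by move=> [Pa la] [Pb lb]; apply/eqP; rewrite eqn_leq la // lb.
have [ys [sys ysm ysr]] : exists ys, [/\ size ys = d, {subset ys <= m} &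
    regseq (zeroS : ideal A) ys].
  have [k [[[ys [sk ysm /regular_seq_regseq ysr]] _] kdim]] := A_cm.
  have dk : d = k.
    apply: is_max_uniq A_dim _; case: kdim => [[P [Pc Pp _]] kmax].
    split; first by exists P.
    move=> e [Q [Qc Qp]]; apply: kmax; exists Q; split=> // e' e'e a a0.
    by have := a0 1; rewrite [_ *: _]mulr1 => ->; exact: ideal0.
  by exists ys; rewrite dk.
have [ys' [sys' ysm' ysr']] : exists ys, [/\ size ys = d, {subset ys <= m} &
    regseq (zeroS : submodClosed M) ys].
  have [[k [[[ys' [sk ysm' /regular_seq_regseq ysr']] _] kdim]] [d' [d'A d'M]]] := M_mcm.
  exists ys'; split=> //; rewrite sk (is_max_uniq _ _ _ kdim d'M).
  exact: is_max_uniq d'A A_dim.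
have [[I1 _] Irad] := I_primary.
have Im : {subset I <= m} by move=> x xI; apply/Irad; exists 1%N; rewrite expr1.
have mI y : y \in m -> exists n, y ^+ n \in I by move/Irad.
have [[J [Jmin [Jred _]]] _] := I_red.
have red1 n : (1 <= n)%N -> mulS J (idealX I n) =i idealX I n.+1.
  by move=> n1; apply: Jred; exact: leq_trans n1.
(* [J] contains [I ^ 2], hence a power of each element of [m]. *)
have mJ y : y \in m -> exists n, y ^+ n \in J.
  move=> /mI[n yn]; exists (n + n)%N; rewrite exprD.
  apply: (@mulS_subl _ J (idealX I 1)); rewrite (red1 1%N) //.
  have yn1 : y ^+ n \in idealX I 1 by rewrite idealX1.
  exact: (mulS_mem (U := A^o)).
have [zs [szs zsJ zsA zsM]] := reduction_regular A_noetherian A_local A_residue A_dim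
  sys ysm ysr (noethM_fg A_noetherian M_fg) sys' ysm' ysr' Im mI mJ Jmin Jred.
(* [mons] lists the variables in the reverse of the order of a regular sequence. *)
rewrite -(revK zs) in zsA zsM; set xs := rev zs in zsA zsM.
have xsJ : lspan (xs : seq A^o) = J by rewrite lspan_rev.
have JI : {subset lspan (xs : seq A^o) <= I} by rewrite xsJ; case: Jmin => [[]].
have powE n : idealX I n.+1 = mulS I (idealX (lspan (xs : seq A^o)) n).
  rewrite xsJ -[n.+1]addn1 (reduction_pow (k := 1) (J := J)) //.
  by rewrite idealX1 mulSC.
case: i i_ge1 t_tor => [//|j] _ [n0 tor].
case: d szs d_ge1 {A_dim sys sys'} => [//|e] szs _.
have size_ms n : size (mons xs n) = 'C(n + e, e).
  have : size xs = e.+1 by rewrite size_rev.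
  by case: (xs) => [//|x xs'] [<-]; rewrite size_mons_cons.
have [b [torb _]] := tor n0 (leqnn _).
move: torb => /tor_length; rewrite powE => torb.
have [|l lP] := tor_len_base zsA zsM JI _ torb.
  by rewrite size_ms bin_gt0 leq_addl.
rewrite subn1 /=; apply: (binomial_poly_degree (l := l) (n0 := n0)) => n n0n.
have [b' [/tor_length]] := tor n n0n; rewrite powE => torb' ->.
rewrite (is_len_uniq torb' (tor_len_power zsA zsM JI n lP)).
by rewrite size_ms.
Qed.
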